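(* Let $\{Z_n\}$ be a critical Galton--Watson process with immigration satisfying condition (A) (as described in the context), with $\sigma=\beta/\gamma>0$. For $r>0$ define $$A(n,r)=\begin{cases} n^{\sigma}, & r>\sigma,\\ \dfrac{n^{\sigma}}{\log n}, & r=\sigma,\\ n^{r}, & r<\sigma.\end{cases}$$ Then for every $r>0$, $$\lim_{n\to\infty}A(n,r)\,\mathbb{E}\big(Z_n^{-r}\,\big|\,Z_n>0\big)=I(r,\sigma),$$ where $$I(r,\sigma)=\begin{cases}\dfrac{1}{\Gamma(r)}\displaystyle\int_0^\infty \big(U(e^{-t})-U(0)\big)t^{r-1}\,dt, & r>\sigma,\\[2mm] \dfrac{1}{\Gamma(r)}\gamma^{-\sigma}, & r=\sigma,\\[2mm] \dfrac{1}{\Gamma(r)}\displaystyle\int_0^\infty(1+\gamma s)^{-\sigma}s^{r-1}\,ds, & r<\sigma.\end{cases}$$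
   Context: Galton--Watson process with immigration: $\{\xi_{ni}: n,i\ge1\}$ are i.i.d. non-negative integer-valued random variables with generating function $f(s)=\sum_{i\ge0}p_is^i$; $\{Y_n:n\ge1\}$ are i.i.d. non-negative integer-valued random variables with generating function $h(s)=\sum_{i\ge0}h_is^i$, independent of $\{\xi_{ni}\}$. Define $Z_0=0$ and $Z_n=\sum_{i=1}^{Z_{n-1}}\xi_{ni}+Y_n$ for $n\ge1$. Let $m=\mathbb{E}\xi_{11}$, $\beta=h'(1)$, $\gamma=\frac12 f''(1)$, $\sigma=\beta/\gamma$. Condition (A): $\gcd\{k:p_k>0\}=1$, $0<p_0<1$, $0<h_0<1$, $m=1$, $0<\beta<\infty$, $0<\gamma<\infty$, $\sum_{j\ge1}p_jj^2\log j<\infty$, $\sum_{j\ge1}h_jj^2<\infty$. The function $U$: let $H_n(x)=\mathbb{E}[x^{Z_n}]=\prod_{k=0}^{n-1}h(f_k(x))$, where $f_k$ is the $k$th iterate of $f$ and $f_0(x)=x$. By a known theorem of Pakes, under condition (A) the limit $U(x)=\lim_{n\to\infty}n^{\sigma}H_n(x)$ exists and is finite for $|x|<1$, uniformly on compact subsets of the open unit disc, and satisfies $h(x)U(f(x))=U(x)$. $\Gamma$ is the Gamma function. *)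

(* Defs.v *)
From HB Require Import structures.
From mathcomp Require Import all_boot all_order all_algebra.
From mathcomp Require Import all_classical all_reals all_analysis.
Import Order.TTheory GRing.Theory Num.Theory.
Import numFieldNormedType.Exports.

Set Implicit Arguments.
Unset Strict Implicit.
Unset Printing Implicit Defensive.

Local Open Scope classical_set_scope.
Local Open Scope ring_scope.

Definition is_gcd_of_set (A : set nat) (g : nat) : Prop :=
  (forall k, A k -> (g %| k)%N) /\
  (forall d : nat, (forall k, A k -> (d %| k)%N) -> (d %| g)%N).

Definition Gamma (R : realType) (r : R) : R :=
  \int[lebesgue_measure]_(t in `]0, +oo[) (t `^ (r - 1) * expR (- t)).

Definition mutually_independent (d d' : measure_display)
    (T : measurableType d) (S : measurableType d') (R : realType)
    (P : probability T R) (I : choiceType) (X : I -> {RV P >-> S}) : Prop :=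
  forall (J : seq I) (B : I -> set S), uniq J ->
    (forall i, i \in J -> measurable (B i)) ->
    P (\bigcap_(i in [set` J]) (X i @^-1` B i)) =
    (\prod_(i <- J) P (X i @^-1` B i))%E.

Definition has_pmf (d : measure_display) (T : measurableType d)
    (R : realType) (P : probability T R) (X : {RV P >-> nat})
    (p : nat -> R) : Prop :=
  forall k : nat, P (X @^-1` [set k]) = (p k)%:E.

Definition cond_expectation (d : measure_display) (T : measurableType d)
    (R : realType) (P : probability T R) (X : T -> R) (A : set T) : R :=
  (\int[P]_(w in A) X w) / fine (P A).

Definition pgf (R : realType) (p : nat -> R) (s : R) : R :=
  limn (series (fun i => p i * s ^+ i)).

(* A generating function need only be defined on [-1, 1], so its k-th
   derivative at 1 is the left limit of its k-th derivative; it may be +oo. *)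
Definition derive_at_1 (R : realType) (k : nat) (g : R -> R) : \bar R :=
  lim ((derive1n k g s)%:E @[s --> (1 : R)^'-]).

(* The indices of xi and Y are shifted to start at 0: xi n i and Y n stand
   for the usual xi_{n+1,i+1} and Y_{n+1}. *)
Fixpoint gwi (T : Type) (xi : nat -> nat -> T -> nat) (Y : nat -> T -> nat)
    (n : nat) (w : T) : nat :=
  if n is n'.+1 then
    (\sum_(i < gwi xi Y n' w) xi n' i w + Y n' w)%N
  else 0%N.

Definition gwi_family (T : Type) (xi : nat -> nat -> T) (Y : nat -> T)
    (j : (nat * nat) + nat) : T :=
  match j with
  | inl (n, i) => xi n i
  | inr n => Y n
  end.

Record gwi_inputs (d : measure_display) (T : measurableType d)
    (R : realType) (P : probability T R) (p h : nat -> R)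
    (xi : nat -> nat -> {RV P >-> nat}) (Y : nat -> {RV P >-> nat}) : Prop := {
  gwi_offspring : forall n i, has_pmf (xi n i) p;
  gwi_immigration : forall n, has_pmf (Y n) h;
  gwi_independent : mutually_independent (gwi_family xi Y) }.

Definition gwi_beta (R : realType) (h : nat -> R) : \bar R :=
  derive_at_1 1 (pgf h).

Definition gwi_gamma (R : realType) (p : nat -> R) : \bar R :=
  ((2^-1)%:E * derive_at_1 2 (pgf p))%E.

Definition gwi_sigma (R : realType) (p h : nat -> R) : R :=
  fine (gwi_beta h) / fine (gwi_gamma p).

Record condition_A (R : realType) (m : \bar R) (p h : nat -> R) : Prop := {
  A_gcd : is_gcd_of_set [set k | 0 < p k] 1;
  A_p0 : 0 < p 0%N < 1;
  A_h0 : 0 < h 0%N < 1;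
  A_critical : m = 1%E;
  A_beta : (0 < gwi_beta h < +oo)%E;
  A_gamma : (0 < gwi_gamma p < +oo)%E;
  A_offspring :
    (\sum_(1 <= j <oo) (p j * j%:R ^+ 2 * ln (j%:R : R))%:E < +oo)%E;
  A_immigration :
    (\sum_(1 <= j <oo) (h j * j%:R ^+ 2)%:E < +oo)%E }.

Definition gwi_H (d : measure_display) (T : measurableType d)
    (R : realType) (P : probability T R) (Z : nat -> T -> nat)
    (n : nat) (x : R) : R :=
  fine ('E_P[fun w => (x ^+ Z n w)%R])%E.

Definition gwi_U (d : measure_display) (T : measurableType d)
    (R : realType) (P : probability T R) (Z : nat -> T -> nat)
    (sigma : R) (x : R) : R :=
  limn (fun n : nat => n%:R `^ sigma * gwi_H P Z n x).

Definition norming (R : realType) (sigma : R) (n : nat) (r : R) : R :=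
  if sigma < r then n%:R `^ sigma
  else if r == sigma then n%:R `^ sigma / ln n%:R
  else n%:R `^ r.

Definition limit_constant (R : realType) (U : R -> R) (gamma : R)
    (r sigma : R) : R :=
  if sigma < r then
    (Gamma r)^-1 *
    \int[lebesgue_measure]_(t in `]0, +oo[)
      ((U (expR (- t)) - U 0) * t `^ (r - 1))
  else if r == sigma then (Gamma r)^-1 * gamma `^ (- sigma)
  else
    (Gamma r)^-1 *
    \int[lebesgue_measure]_(s in `]0, +oo[)
      ((1 + gamma * s) `^ (- sigma) * s `^ (r - 1)).

(* Main.v *)
Require Import Defs.
From HB Require Import structures.
From mathcomp Require Import all_boot all_order all_algebra.
From mathcomp Require Import all_classical all_reals all_analysis.
From mathcomp Require Import measurable_realfun ring lra.
Import Order.TTheory GRing.Theory Num.Theory.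
Import numFieldNormedType.Exports.
Local Open Scope classical_set_scope.
Local Open Scope ring_scope.
Set Implicit Arguments.
Unset Strict Implicit.

(** Write [f] and [h] for the generating functions of the offspring and of the
    immigration, $f_k$ for the iterates of [f], and $H_n(x) = E[x^{Z_n}]$.
    Averaging the Euler integral for $k^{-r}$ over the law of $Z_n$ gives, for
    every $c > 0$,
      $$\Gamma(r)\, c^r\, E[Z_n^{-r}; Z_n > 0] =
        \int_0^\infty (H_n(e^{-s/c}) - H_n(0))\, s^{r-1}\, ds$$
    ([negative_moment_integral]), and $P(Z_n > 0) = 1 - H_n(0)$ tends to 1.  So
    the theorem is a statement about $H_n$ near 1.

    Conditioning on $Z_n$ gives $H_{n+1}(x) = h(x) H_n(f(x))$ ([gwi_HS]), hence
    $H_n(x) = \prod_{k<n} h(f_k(x))$.  In the coordinate $1/(1-x)$ the map [f] is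
    nearly the translation by $\gamma$, so that $1/(1-f_n(x))$ is close to
    $1/(1-x) + \gamma n$.  Since $\log h(x)$ is close to $-\beta (1-x)$ and
    $\beta = \sigma\gamma$, the product $H_n(x)$ compares with
    $((1-f_n(x))/(1-x))^\sigma$: the logarithm of their quotient is a sum over
    [k] of a defect of $f_k(x)$ ([hprodE]).  The condition on
    $\sum_j p_j j^2 \log j$ makes the defects along an orbit summable
    ([is_cvg_gap]), and since their bound decreases along orbits, the total is
    bounded uniformly in [x] and vanishes as [x] tends to 1.  Three facts follow: $n^\sigma H_n(x)$
    converges ([is_cvg_hprod]), $H_n(x) = O((n(1-x))^{-\sigma})$ uniformly
    ([hprod_le]), and $H_n(e^{-t_n}) (1 + \gamma n t_n)^\sigma$ tends to 1 when
    $t_n$ tends to 0 ([hprod_diagonal]).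

    The uniform bound yields
    $H_n(e^{-t}) - H_n(0) = O((nt)^{-\sigma} e^{-t/4})$ ([psi_le]), which
    dominates all the integrals.  For $r > \sigma$ take $c = 1$: the mass sits at
    [s] of order 1 and the limit involves the function [U] of the theorem.  For
    $r < \sigma$ take $c = n$: the limiting integrand is
    $(1 + \gamma s)^{-\sigma} s^{r-1}$.  For $r = \sigma$ and $c = n$ the integrand
    is about $\gamma^{-\sigma}/s$ for $1 < s < n$, which produces the factor
    $\log n$. *)

(** * Series of nonnegative reals *)

Section Series.
Context {R : realType}.
Implicit Types u v : nat -> R.

Lemma is_cvg_series_le u v : (forall k, 0 <= u k <= v k) ->
  cvgn (series v) -> cvgn (series u).
Proof.
move=> uv; apply: series_le_cvg => k; have /andP[u0 le_uv] := uv k => //.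
exact: le_trans u0 le_uv.
Qed.

Lemma sum_le u v : (forall k, 0 <= u k <= v k) -> cvgn (series v) ->
  limn (series u) <= limn (series v).
Proof.
move=> uv cv; apply: lim_series_le => //; first exact: is_cvg_series_le cv.
by move=> k; have /andP[] := uv k.
Qed.

Lemma partial_le_sum u n : (forall k, 0 <= u k) -> cvgn (series u) ->
  series u n <= limn (series u).
Proof.
move=> u0 cu; apply: nondecreasing_cvgn_le => //.
by apply/nondecreasing_seqP => k; rewrite seriesSr lerDl.
Qed.

Lemma sum_ge0 u : (forall k, 0 <= u k) -> cvgn (series u) ->
  0 <= limn (series u).
Proof.
move=> u0 cu; apply: le_trans (partial_le_sum 0 u0 cu).
by rewrite /series /= big_geq.
Qed.

Lemma is_cvg_sumD u v : cvgn (series u) -> cvgn (series v) ->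
  cvgn (series (fun k => u k + v k)).
Proof. exact: is_cvg_seriesD. Qed.

Lemma sumD u v : cvgn (series u) -> cvgn (series v) ->
  limn (series (fun k => u k + v k)) = limn (series u) + limn (series v).
Proof. exact: lim_seriesD. Qed.

Lemma is_cvg_sumZ (c : R) u : cvgn (series u) ->
  cvgn (series (fun k => c * u k)).
Proof. exact: is_cvg_seriesZ. Qed.

Lemma sumZ (c : R) u : cvgn (series u) ->
  limn (series (fun k => c * u k)) = c * limn (series u).
Proof. exact: lim_seriesZ. Qed.

Lemma is_cvg_sum_big (w : nat -> nat -> R) n :
  (forall i, cvgn (series (w i))) ->
  cvgn (series (fun k => \sum_(i < n) w i k)) /\
  limn (series (fun k => \sum_(i < n) w i k)) =
    \sum_(i < n) limn (series (w i)).
Proof.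
move=> cw; elim: n => [|n [IH IHE]].
  rewrite big_ord0.
  have c0 : series (fun k => \sum_(i < 0) w i k) @ \oo --> (0 : R).
    apply: cvg_near_cst; apply: nearW => m.
    by rewrite /series /= big1 // => k _; rewrite big_ord0.
  by split; [apply/cvg_ex; exists 0 | exact/cvg_lim].
have -> : (fun k => \sum_(i < n.+1) w i k) =
    (fun k => \sum_(i < n) w i k + w n k).
  by apply/funext => k; rewrite big_ord_recr.
split; first exact: (is_cvg_sumD IH (cw n)).
by rewrite big_ord_recr /= (sumD IH (cw n)) IHE.
Qed.

Lemma sum_shift u : cvgn (series u) ->
  cvgn (series (fun k => u k.+1)) /\
  limn (series (fun k => u k.+1)) = limn (series u) - u 0%N.
Proof.
move=> cu.
have E : series (fun k => u k.+1) = (fun n => series u n.+1 - u 0%N).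
  by apply/funext => n; rewrite /series /= big_nat_recl //= addrC addKr.
have cvg_shift : series (fun k => u k.+1) @ \oo --> limn (series u) - u 0%N.
  by rewrite E; apply: cvgB; [rewrite cvg_shiftS | exact: cvg_cst].
by split; [apply/cvg_ex; eexists; exact: cvg_shift | exact/cvg_lim].
Qed.

(** Monotone convergence for series along an arbitrary filter: a partial sum
    of the limit is approached by partial sums, which bound the full sums from
    below. *)
Lemma cvg_sum_dominated (T : Type) (F : set_system T) (FF : Filter F)
    (u : T -> nat -> R) v :
  cvgn (series v) -> (\forall x \near F, forall k, 0 <= u x k <= v k) ->
  (forall k, u x k @[x --> F] --> v k) ->
  limn (series (u x)) @[x --> F] --> limn (series v).
Proof.
move=> cv uv ucvg; apply/cvgrPdist_le => e e0.
have e20 : 0 < e / 2 by rewrite divr_gt0.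
have /cvgrPdist_le/(_ _ e20)[N _ /(_ N (leqnn N)) /= HN] := cv.
have pcvg : series (u x) N @[x --> F] --> series v N.
  rewrite /series /=.
  elim: N {HN} => [|N IH].
    under eq_fun do rewrite big_geq //.
    by rewrite big_geq //; exact: cvg_cst.
  under eq_fun do rewrite big_nat_recr //=.
  by rewrite big_nat_recr //=; apply: cvgD.
have /cvgrPdist_le/(_ _ e20) pN := pcvg.
near=> x.
have uvx : forall k, 0 <= u x k <= v k by near: x.
have : `|series v N - series (u x) N| <= e / 2 by near: x.
have cux := is_cvg_series_le uvx cv.
have := sum_le uvx cv.
have := @partial_le_sum (u x) N (fun k => proj1 (andP (uvx k))) cux.
move: HN; rewrite !ler_norml => /andP[_ H1] H2 H3 /andP[_ H4].
by apply/andP; split; lra.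
Unshelve. all: by end_near.
Qed.

(** With nonnegative coefficients Abel's theorem is monotone convergence. *)
Lemma abel_sum u : (forall k, 0 <= u k) -> cvgn (series u) ->
  pgf u s @[s --> (1 : R)^'-] --> limn (series u).
Proof.
move=> u0 cu; apply: cvg_sum_dominated => //.
  near=> s; have s01 : 0 <= s <= 1.
    by apply/andP; split; [near: s; exact: nbhs_left_ge | near: s; exact: nbhs_left_le].
  have /andP[s0 s1] := s01.
  by move=> k; rewrite mulr_ge0 ?exprn_ge0 //= ler_piMr // exprn_ile1.
move=> k; rewrite -[X in _ --> X]mulr1; apply: cvgM; first exact: cvg_cst.
rewrite -[X in _ --> X](expr1n R k).
apply: cvg_at_left_filter; exact: exprn_continuous.
Unshelve. all: by end_near.
Qed.

Lemma is_cvg_pgf u (s : R) : (forall k, 0 <= u k) -> cvgn (series u) ->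
  0 <= s <= 1 -> cvgn (series (fun i => u i * s ^+ i)).
Proof.
move=> u0 cu /andP[s0 s1]; apply: is_cvg_series_le cu => k.
by rewrite mulr_ge0 ?exprn_ge0 //= ler_piMr // exprn_ile1.
Qed.

Lemma EFin_sum u : (forall k, 0 <= u k) -> cvgn (series u) ->
  (limn (series u))%:E = (\sum_(k <oo) (u k)%:E)%E.
Proof.
move=> u0 cu; rewrite -EFin_lim //; congr (limn _); apply/funext => n /=.
by rewrite sumEFin.
Qed.

Lemma is_cvg_sum_lty u : (forall k, 0 <= u k) ->
  (\sum_(k <oo) (u k)%:E < +oo)%E -> cvgn (series u).
Proof. by move=> u0; exact: nnseries_is_cvg. Qed.

End Series.
Arguments is_cvg_sumZ {R} c {u} _.

(** * Power series with nonnegative coefficients near 1 *)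
Section Remainder.
Context {R : realType}.
Implicit Types (s t : R) (j : nat) (a b : nat -> R).

(** The coefficient $(s^j - 1 + j(1-s)) / (1-s)^2$ of the second-order expansion
    of $s^j$ at 1, in a form that is visibly nonnegative and nondecreasing in [s]. *)
Definition rem2 s j : R := \sum_(i < j) \sum_(l < i) s ^+ l.

Lemma rem2S s j : rem2 s j.+1 = rem2 s j + \sum_(l < j) s ^+ l.
Proof. by rewrite /rem2 big_ord_recr. Qed.

Lemma exprE_rem2 s j :
  s ^+ j = 1 - j%:R * (1 - s) + (1 - s) ^+ 2 * rem2 s j.
Proof.
elim: j => [|j IH]; first by rewrite /rem2 big_ord0 expr0; ring.
have geo : (1 - s) * \sum_(l < j) s ^+ l = 1 - s ^+ j.
  by rewrite -opprB mulNr -subrX1 opprB.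
have -> : (1 - s) ^+ 2 * rem2 s j.+1 =
    (1 - s) ^+ 2 * rem2 s j + (1 - s) * (1 - s ^+ j).
  by rewrite rem2S -geo; ring.
by rewrite exprS -(addn1 j) natrD IH; ring.
Qed.

Lemma rem2_ge0 s j : 0 <= s -> 0 <= rem2 s j.
Proof. by move=> s0; do 2! apply: sumr_ge0 => ? _; exact: exprn_ge0. Qed.

Lemma le_rem2 s t j : 0 <= s -> s <= t -> rem2 s j <= rem2 t j.
Proof.
move=> s0 st; do 2! apply: ler_sum => ? _.
by apply: lerXn2r => //; rewrite nnegrE ?(le_trans s0).
Qed.

Lemma rem2_1E j : 2 * rem2 1 j = j%:R * (j%:R - 1) :> R.
Proof.
elim: j => [|j IH]; first by rewrite /rem2 big_ord0 mulr0 mul0r.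
rewrite rem2S mulrDr IH; under eq_bigr do rewrite expr1n.
by rewrite sumr_const card_ord -(addn1 j) natrD; ring.
Qed.

Lemma rem2_1_le j : rem2 1 j <= j%:R ^+ 2 :> R.
Proof.
have := rem2_1E j; have : (0 : R) <= j%:R by []; nra.
Qed.

Lemma rem2_le s j : 0 <= s <= 1 -> rem2 s j <= j%:R ^+ 2.
Proof.
by move=> /andP[s0 s1]; apply: le_trans (rem2_1_le j); exact: le_rem2.
Qed.

Lemma bernoulli_inequality s l : 0 <= s <= 1 -> 1 - s ^+ l <= l%:R * (1 - s).
Proof.
move=> s01; have /andP[s0 s1] := s01.
by rewrite exprE_rem2; have := rem2_ge0 l s0; have := sqr_ge0 (1 - s); nra.
Qed.

Lemma rem2_diff_le s j : 0 <= s <= 1 ->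
  rem2 1 j - rem2 s j <= j%:R ^+ 2 * (j%:R * (1 - s)).
Proof.
move=> s01; have /andP[s0 s1] := s01.
have q0 : 0 <= 1 - s by rewrite subr_ge0.
have C0 : 0 <= j%:R * (1 - s) by rewrite mulr_ge0.
have inner (i : 'I_j) : \sum_(l < i) (1 ^+ l - s ^+ l) <= j%:R * (j%:R * (1 - s)).
  apply: (@le_trans _ _ (\sum_(l < i) j%:R * (1 - s))).
    apply: ler_sum => l _; rewrite expr1n.
    apply: le_trans (bernoulli_inequality l s01) _; apply: ler_wpM2r => //.
    by rewrite ler_nat ltnW // (ltn_trans (ltn_ord l)).
  rewrite sumr_const card_ord -[leLHS]mulr_natl; apply: ler_wpM2r => //.
  by rewrite ler_nat ltnW.
rewrite /rem2 -sumrB.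
apply: (@le_trans _ _ (\sum_(i < j) j%:R * (j%:R * (1 - s)))).
  by apply: ler_sum => i _; rewrite -sumrB; exact: inner.
by rewrite sumr_const card_ord -[leLHS]mulr_natl expr2 -mulrA.
Qed.

Lemma pgf_expansion a s : (forall k, 0 <= a k) ->
  cvgn (series a) -> cvgn (series (fun k => a k * k%:R)) ->
  cvgn (series (fun k => a k * k%:R ^+ 2)) -> 0 <= s <= 1 ->
  pgf a s = limn (series a) - (1 - s) * limn (series (fun k => a k * k%:R))
    + (1 - s) ^+ 2 * limn (series (fun k => a k * rem2 s k)).
Proof.
move=> a0 ca ca1 ca2 s01; have /andP[s0 s1] := s01.
have cr : cvgn (series (fun k => a k * rem2 s k)).
  apply: is_cvg_series_le ca2 => k.
  by rewrite mulr_ge0 ?rem2_ge0 //= ler_wpM2l // rem2_le.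
have cr' := is_cvg_sumZ ((1 - s) ^+ 2) cr.
have ca1' := is_cvg_sumZ (- (1 - s)) ca1.
rewrite -mulNr -!sumZ // -sumD //.
rewrite -(sumD (is_cvg_sumD ca ca1') cr') /pgf.
congr (limn (series _)); apply/funext => k.
by rewrite [in LHS]exprE_rem2; ring.
Qed.

Lemma diffs_ge0 a : (forall k, 0 <= a k) -> forall k, 0 <= pseries_diffs a k.
Proof. by move=> a0 k; rewrite /pseries_diffs mulr_ge0. Qed.

(** The summability of [a] suffices since
    $(k+1) s^k \le \sum_{l \le k} s^l \le 1/(1-s)$. *)
Lemma is_cvg_pseries_diffs_inside a s : (forall k, 0 <= a k) ->
  cvgn (series a) -> 0 <= s < 1 -> cvgn (pseries (pseries_diffs a) s).
Proof.
move=> a0 ca /andP[s0 s1]; have q0 : 0 < 1 - s by rewrite subr_gt0.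
have [ca' _] := sum_shift ca.
apply: (is_cvg_series_le _ (is_cvg_sumZ (1 - s)^-1 ca')) => k.
rewrite /pseries_diffs !mulr_ge0 ?exprn_ge0 //=.
rewrite mulrAC ler_wpM2r // -[leRHS]mulr1 ler_pdivlMl //.
have -> : k.+1%:R * s ^+ k = \sum_(l < k.+1) s ^+ k.
  by rewrite sumr_const card_ord mulr_natl.
apply: (@le_trans _ _ ((1 - s) * \sum_(l < k.+1) s ^+ l)).
  rewrite ler_wpM2l ?(ltW q0) //; apply: ler_sum => l _.
  by rewrite ler_wiXn2l // ?(ltW s1) // -ltnS.
by rewrite -opprB mulNr -subrX1 opprB gerBl exprn_ge0.
Qed.

Lemma is_derive_pgf a s : (forall k, 0 <= a k) ->
  cvgn (series a) -> cvgn (series (pseries_diffs a)) -> 0 < s < 1 ->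
  is_derive s (1 : R) (pgf a) (pgf (pseries_diffs a) s).
Proof.
move=> a0 ca cda /andP[s0 s1].
have K01 : 0 <= (1 + s) / 2 < 1 by apply/andP; split; lra.
have K01' : 0 <= (1 + s) / 2 <= 1 by apply/andP; split; lra.
apply: (@pseries_snd_diffs R a ((1 + s) / 2)).
- exact: is_cvg_pgf.
- exact: is_cvg_pgf (diffs_ge0 a0) cda K01'.
- exact: is_cvg_pseries_diffs_inside (diffs_ge0 a0) cda K01.
- by rewrite !ger0_norm; lra.
Qed.

Lemma is_cvg_diffs a : cvgn (series (fun k => a k * k%:R)) ->
  cvgn (series (pseries_diffs a)) /\
  limn (series (pseries_diffs a)) = limn (series (fun k => a k * k%:R)).
Proof.
move=> ca; have [c E] := sum_shift ca.
have -> : pseries_diffs a = (fun k => a k.+1 * k.+1%:R).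
  by apply/funext => k; rewrite /pseries_diffs mulrC.
by split => //; rewrite E mulr0 subr0.
Qed.

Lemma derive_at_1_pgf1 a : (forall k, 0 <= a k) ->
  cvgn (series a) -> cvgn (series (fun k => a k * k%:R)) ->
  derive_at_1 1 (pgf a) = (limn (series (fun k => a k * k%:R)))%:E.
Proof.
move=> a0 ca ca1; have [cda <-] := is_cvg_diffs ca1.
apply: cvg_lim => //; apply: cvg_EFin; first exact: nearW.
apply: cvg_trans (abel_sum (diffs_ge0 a0) cda).
apply: near_eq_cvg; near=> s; rewrite /= derive1E.
have s01 : 0 < s < 1.
  by apply/andP; split; near: s; [exact: nbhs_left_gt | exact: nbhs_left_lt].
by have -> := @derive_val _ _ _ _ _ _ _ (is_derive_pgf a0 ca cda s01).
Unshelve. all: by end_near.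
Qed.

(** Twice the sum of [a k * rem2 1 k] is the second factorial moment. *)
Lemma derive_at_1_pgf2 a : (forall k, 0 <= a k) ->
  cvgn (series a) -> cvgn (series (fun k => a k * k%:R)) ->
  cvgn (series (fun k => a k * k%:R ^+ 2)) ->
  derive_at_1 2 (pgf a) = (2 * limn (series (fun k => a k * rem2 1 k)))%:E.
Proof.
move=> a0 ca ca1 ca2; have [cda Eda] := is_cvg_diffs ca1.
have cr : cvgn (series (fun k => a k * rem2 1 k)).
  apply: is_cvg_series_le ca2 => k.
  by rewrite mulr_ge0 ?rem2_ge0 //= ler_wpM2l // rem2_1_le.
have [c2 E2] := sum_shift (is_cvg_sumZ 2 cr).
have E : (fun k => pseries_diffs a k * k%:R) =
    (fun k => 2 * (a k.+1 * rem2 1 k.+1)).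
  apply/funext => k; rewrite /pseries_diffs mulrCA rem2_1E.
  by rewrite -(addn1 k) natrD; ring.
have cda1 : cvgn (series (fun k => pseries_diffs a k * k%:R)) by rewrite E.
have [cdda Edda] := is_cvg_diffs cda1.
have -> : 2 * limn (series (fun k => a k * rem2 1 k)) =
    limn (series (pseries_diffs (pseries_diffs a))).
  by rewrite Edda E E2 /= /rem2 big_ord0 !mulr0 subr0 sumZ.
have da0 := diffs_ge0 a0.
apply: cvg_lim => //; apply: cvg_EFin; first exact: nearW.
apply: cvg_trans (abel_sum (diffs_ge0 da0) cdda).
apply: near_eq_cvg; near=> s; rewrite /=.
have s01 : 0 < s < 1.
  by apply/andP; split; near: s; [exact: nbhs_left_gt | exact: nbhs_left_lt].
rewrite derive1E.
have -> : 'D_1 (derive1 (pgf a)) s = 'D_1 (pgf (pseries_diffs a)) s.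
  apply: near_eq_derive.
  have /andP[s0 s1] := s01.
  near=> t; rewrite derive1E.
  have t01 : 0 < t < 1.
    apply/andP; split; near: t; [exact: lt_nbhsr | exact: lt_nbhsl].
  by have -> := @derive_val _ _ _ _ _ _ _ (is_derive_pgf a0 ca cda t01).
by have -> := @derive_val _ _ _ _ _ _ _ (is_derive_pgf da0 cda cdda s01).
Unshelve. all: by end_near.
Qed.

End Remainder.

(** * Critical generating functions *)
Section LogBounds.
Context {R : realType}.

Lemma ln_bounds (y : R) : 0 < y -> 1 - y^-1 <= ln y <= y - 1.
Proof.
have ln_le (x : R) : 0 < x -> ln x <= x - 1.
  by move=> x0; have := expR_ge1Dx (ln x); rewrite lnK ?posrE //; lra.
move=> y0; rewrite ln_le // andbT.
have : ln y^-1 <= y^-1 - 1 by apply: ln_le; rewrite invr_gt0.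
by rewrite lnV ?posrE //; lra.
Qed.

(** The error term is quadratic in [1 - y] as long as [y] stays away from 0. *)
Lemma ln_quadratic (y : R) : 0 < y ->
  (y - 1) - (1 - y) ^+ 2 / y <= ln y <= y - 1.
Proof.
move=> y0; have /andP[H1 H2] := ln_bounds y0; rewrite H2 andbT.
apply: le_trans H1; rewrite le_eqVlt; apply/orP; left; apply/eqP; field.
by rewrite gt_eqF.
Qed.

Lemma harmonic_le j : (0 < j)%N ->
  \sum_(k < j) (k.+1%:R)^-1 <= 1 + ln j%:R :> R.
Proof.
rewrite -(big_mkord xpredT (fun k => (k.+1%:R)^-1)).
case: j => // j _; elim: j => [|j IH].
  by rewrite big_nat1 ln1 invr1; lra.
rewrite big_nat_recr //=.
have j0 : (0 : R) < j.+1%:R by rewrite ltr0n.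
have j1 : (0 : R) < j.+2%:R by rewrite ltr0n.
have : 1 - (j.+2%:R / j.+1%:R)^-1 <= ln (j.+2%:R / j.+1%:R : R).
  by have /andP[] := ln_bounds (divr_gt0 j1 j0).
rewrite ln_div ?posrE // invf_div.
have -> : 1 - j.+1%:R / j.+2%:R = (j.+2%:R)^-1 :> R.
  by move: j1; rewrite -(natr1 j.+1) => j1; field; rewrite lt0r_neq0.
move=> step; rewrite -(subrK (ln j.+1%:R) (ln j.+2%:R)) [X in 1 + X]addrC addrA.
exact: lerD.
Qed.

(** The sum telescopes over a window of length [j], which leaves at most the
    [j]-th harmonic number. *)
Lemma telescoping_harmonic_le j N : (0 < j)%N ->
  \sum_(k < N) j%:R / (k.+1%:R * (k.+1 + j)%:R) <= 1 + ln j%:R :> R.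
Proof.
move=> j0; apply: le_trans (harmonic_le j0).
have E (k : nat) : j%:R / (k.+1%:R * (k.+1 + j)%:R) =
    (k.+1%:R)^-1 - ((k.+1 + j)%:R)^-1 :> R.
  have F (x y : R) : x != 0 -> x + y != 0 -> y / (x * (x + y)) = x^-1 - (x + y)^-1.
    by move=> x0 xy0; field; rewrite x0 xy0.
  by rewrite natrD F -?natrD // pnatr_eq0 ?addSn.
under eq_bigr do rewrite E.
rewrite sumrB lerBlDr.
have -> : \sum_(k < j) (k.+1%:R)^-1 + \sum_(k < N) ((k.+1 + j)%:R)^-1 =
    \sum_(k < j + N) (k.+1%:R)^-1 :> R.
  rewrite big_split_ord /=; congr (_ + _); apply: eq_bigr => k _.
  by rewrite addnC addnS.
rewrite addnC big_split_ord /= lerDl; apply: sumr_ge0 => k _.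
by rewrite invr_ge0.
Qed.

End LogBounds.

(** The analytic input of the asymptotics.  [g] is the second-order difference
    quotient of [f] at the fixed point 1, so that [gam] is half the second
    derivative there, and [c] is a lower bound for the speed at which iterates
    drift to 1.  [nc_sum] is the form in which the condition on
    $\sum_j p_j j^2 \log j$ enters: the summation points [1 - (1 + c k)^-1] stay
    below the iterates of 0, and they approach 1 at the same rate $1/k$. *)
Record near_critical (R : realType) (f h g : R -> R) (gam beta c B : R) :
  Prop := {
  nc_c : 0 < c <= 1;
  nc_f : forall s, 0 <= s < 1 -> f s = s + (1 - s) ^+ 2 * g s;
  nc_f_lt1 : forall s, 0 <= s < 1 -> c * (1 - s) <= 1 - f s;
  nc_g : forall s, 0 <= s < 1 -> c <= g s <= gam;
  nc_g_mono : forall s t, 0 <= s -> s <= t -> t < 1 -> g s <= g t;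
  nc_g_lim : g s @[s --> (1 : R)^'-] --> gam;
  nc_sum : cvgn (series (fun k =>
    (1 + c * k%:R)^-1 * (gam - g (1 - (1 + c * k%:R)^-1))));
  nc_h : forall s, 0 <= s < 1 -> 0 < h s <= 1;
  nc_ln_h : forall s, 0 <= s < 1 ->
    `|ln (h s) + beta * (1 - s)| <= B * (1 - s) ^+ 2 }.

Section NearCritical.
Context {R : realType} (p h : nat -> R).
Hypotheses (p0 : forall k, 0 <= p k) (h0 : forall k, 0 <= h k).
Hypotheses (cp : cvgn (series p)) (ch : cvgn (series h)).
Hypotheses (p1 : limn (series p) = 1) (h1 : limn (series h) = 1).
Hypotheses (cpm : cvgn (series (fun k => p k * k%:R)))
  (pm : limn (series (fun k => p k * k%:R)) = 1).
Hypothesis cpl : cvgn (series (fun k => p k * k%:R ^+ 2 * ln k%:R)).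
Hypothesis ch2 : cvgn (series (fun k => h k * k%:R ^+ 2)).
Hypotheses (pp : 0 < p 0%N < 1) (hp : 0 < h 0%N < 1).

Lemma is_cvg_second_moment : cvgn (series (fun k => p k * k%:R ^+ 2)).
Proof.
have l2 : 0 < ln (2 : R) by apply: ln_gt0; lra.
have c := is_cvg_sumD cp (is_cvg_sumZ (ln (2 : R))^-1 cpl).
apply: is_cvg_series_le c => k; rewrite mulr_ge0 //=.
case: k => [|[|k]].
- by rewrite expr2 !mulr0 mul0r mulr0 addr0.
- by rewrite ln1 expr1n !mulr1 mulr0 mulr0 addr0.
apply: ler_wpDl => //; rewrite ler_pdivlMl // mulrC ler_wpM2l //.
  by rewrite mulr_ge0.
by rewrite ler_ln ?posrE // ler_nat.
Qed.

Let cp2 := is_cvg_second_moment.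

Lemma is_cvg_rem2 (a : nat -> R) (s : R) : (forall k, 0 <= a k) ->
  cvgn (series (fun k => a k * k%:R ^+ 2)) -> 0 <= s <= 1 ->
  cvgn (series (fun k => a k * rem2 s k)).
Proof.
move=> a0 ca s01; have /andP[s0 s1] := s01; apply: is_cvg_series_le ca => k.
by rewrite mulr_ge0 ?rem2_ge0 //= ler_wpM2l // rem2_le.
Qed.

Lemma is_cvg_first_moment_of_second (a : nat -> R) : (forall k, 0 <= a k) ->
  cvgn (series (fun k => a k * k%:R ^+ 2)) ->
  cvgn (series (fun k => a k * k%:R)).
Proof.
move=> a0; apply: is_cvg_series_le => k; rewrite mulr_ge0 //=.
by rewrite ler_wpM2l // -natrX ler_nat; case: k => // k; rewrite leq_pmull.
Qed.

Definition half_variance : R := limn (series (fun k => p k * rem2 1 k)).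
Definition immigration_mean : R := limn (series (fun k => h k * k%:R)).
Definition curvature (s : R) : R := limn (series (fun k => p k * rem2 s k)).
Definition drift_floor : R := Num.min (p 0%N) (1 - p 0%N).

Let s01W (s : R) : 0 <= s < 1 -> 0 <= s <= 1.
Proof. by move=> /andP[-> /ltW ->]. Qed.

Lemma pgf_p_expansion (s : R) : 0 <= s <= 1 ->
  pgf p s = s + (1 - s) ^+ 2 * curvature s.
Proof.
move=> s01; rewrite pgf_expansion // p1 pm /curvature; ring.
Qed.

Lemma le_curvature (s t : R) : 0 <= s -> s <= t -> t <= 1 -> curvature s <= curvature t.
Proof.
move=> s0 st t1; apply: sum_le; last first.
  by apply: is_cvg_rem2 => //; rewrite (le_trans s0).
by move=> k; rewrite mulr_ge0 ?rem2_ge0 //= ler_wpM2l // le_rem2.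
Qed.

Lemma pgf0 (a : nat -> R) : pgf a 0 = a 0%N.
Proof.
apply/cvg_lim => //; apply: cvg_near_cst; exists 1%N => // n n0.
rewrite /series /= big_mkord.
case: n n0 => // n _; rewrite big_ord_recl expr0 mulr1 big1 ?addr0 // => i _.
by rewrite expr0n mulr0.
Qed.

Lemma curvature0 : curvature 0 = p 0%N.
Proof.
have := @pgf_p_expansion 0; rewrite pgf0 lexx ler01 => /(_ isT) ->; ring.
Qed.

(** The graph of [pgf p] lies below its chord from 0 to 1. *)
Lemma pgf_p_le (s : R) : 0 <= s <= 1 -> pgf p s <= p 0%N + (1 - p 0%N) * s.
Proof.
move=> s01; have /andP[s0 s1] := s01.
have cs := is_cvg_pgf p0 cp s01.
have [c E] := sum_shift cs; have [c' E'] := sum_shift cp.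
rewrite -p1.
have -> : pgf p s = p 0%N + limn (series (fun k => p k.+1 * s ^+ k.+1)).
  by rewrite E expr0 mulr1 addrC subrK.
rewrite lerD2l -E' mulrC -sumZ //; apply: sum_le; last exact: is_cvg_sumZ.
move=> k; rewrite mulr_ge0 ?exprn_ge0 //= mulrC ler_wpM2r //.
by rewrite exprS ler_piMr // exprn_ile1.
Qed.

Lemma curvature_lim : curvature s @[s --> (1 : R)^'-] --> half_variance.
Proof.
apply: cvg_sum_dominated; first by apply: is_cvg_rem2 => //; rewrite ler01 lexx.
  near=> s => k; have s0 : 0 <= s by near: s; exact: nbhs_left_ge.
  by rewrite mulr_ge0 ?rem2_ge0 //= ler_wpM2l // le_rem2.
move=> k; apply: cvgM; first exact: cvg_cst.
apply: cvg_at_left_filter.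
apply: cvg_big => [|i _]; first exact: add_continuous.
apply: cvg_big => [|l _]; first exact: add_continuous.
exact: exprn_continuous.
Unshelve. all: by end_near.
Qed.

(** Each term [rem2 1 j - rem2 s j] is at most [j ^ 2] times the minimum of 1
    and [j * (1 - s)], hence at most [2 j^2 * j q / (1 + j q)] with
    [q = 1 - s]; along [q = 1 / (1 + c k)] these telescope into a harmonic
    number, of size [ln j]. *)
Lemma rem2_gap_le (c : R) j k : 0 < c <= 1 ->
  let q := (1 + c * k%:R)^-1 in
  q * (rem2 1 j - rem2 (1 - q) j) <=
    2 / c ^+ 2 * j%:R ^+ 2 * (j%:R / (k.+1%:R * (k.+1 + j)%:R)).
Proof.
move=> /andP[c0 c1]; cbv zeta; set q := (1 + c * k%:R)^-1.
have k0 : (0 : R) <= k%:R by [].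
have j0 : (0 : R) <= j%:R by [].
have ck : 0 < 1 + c * k%:R by nra.
have q0 : 0 < q by rewrite invr_gt0.
have q1 : q <= 1 by rewrite invf_le1 //; nra.
have s01 : 0 <= 1 - q <= 1 by apply/andP; split; lra.
have /andP[s0 _] := s01.
have d0 : 0 <= rem2 1 j - rem2 (1 - q) j by rewrite subr_ge0 le_rem2; lra.
have d1 : rem2 1 j - rem2 (1 - q) j <= j%:R ^+ 2.
  have := @rem2_1_le R j; have := rem2_ge0 j s0; lra.
have d2 := rem2_diff_le j s01; rewrite subKr in d2.
have jq0 : 0 <= j%:R * q by rewrite mulr_ge0 // ltW.
have dq : (rem2 1 j - rem2 (1 - q) j) * (1 + j%:R * q) <= 2 * (j%:R ^+ 2 * (j%:R * q)).
  rewrite mulrDr mulr1; set D := _ - _ in d0 d1 d2 *.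
  have := ler_wpM2r jq0 d1; lra.
have step : q * (rem2 1 j - rem2 (1 - q) j) <=
    2 * j%:R ^+ 2 * (j%:R / ((1 + c * k%:R) * (1 + c * k%:R + j%:R))).
  have -> : 2 * j%:R ^+ 2 * (j%:R / ((1 + c * k%:R) * (1 + c * k%:R + j%:R))) =
      q * (2 * (j%:R ^+ 2 * (j%:R * q)) / (1 + j%:R * q)).
    rewrite /q; field; rewrite gt_eqF ?gt_eqF //=; nra.
  rewrite ler_wpM2l ?(ltW q0) // ler_pdivlMr //; lra.
apply: le_trans step _.
have -> : 2 / c ^+ 2 * j%:R ^+ 2 * (j%:R / (k.+1%:R * (k.+1 + j)%:R)) =
    2 * j%:R ^+ 2 * (j%:R / ((c * k.+1%:R) * (c * (k.+1 + j)%:R))) :> R.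
  have F (x y u v : R) : x != 0 -> y != 0 ->
      2 / c ^+ 2 * u ^+ 2 * (u / (x * y)) = 2 * u ^+ 2 * (u / (c * x * (c * y))).
    by move=> x0 y0; field; rewrite x0 y0 gt_eqF.
  by apply: F; rewrite // pnatr_eq0 ?addSn.
rewrite ler_wpM2l ?mulr_ge0 ?sqr_ge0 // ler_wpM2l // lef_pV2 ?posrE.
- rewrite natrD -natr1; apply: ler_pM; nra.
- by nra.
- by rewrite mulr_gt0 // mulr_gt0 ?ltr0n // addSn ltr0n.
Qed.

(** Summing [rem2_gap_le] first over [k] and then over [j] leaves a multiple of
    $\sum_j p_j j^2 (1 + \log j)$. *)
Lemma is_cvg_gap (c : R) : 0 < c <= 1 ->
  cvgn (series (fun k => (1 + c * k%:R)^-1 * (half_variance - curvature (1 - (1 + c * k%:R)^-1)))).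
Proof.
move=> c01; have /andP[c0 c1] := c01.
set q := fun k : nat => (1 + c * k%:R)^-1.
have ck k : 1 <= 1 + c * k%:R by rewrite lerDl mulr_ge0 // ltW.
have q01 k : 0 <= 1 - q k <= 1.
  have := ck k; rewrite -(invf_le1 (lt_le_trans ltr01 (ck k))) => q1.
  rewrite subr_ge0 q1 gerBl invr_ge0 (le_trans ler01 (ck k)) //.
have q0 k : 0 <= q k by rewrite invr_ge0 (le_trans ler01 (ck k)).
have one01 : 0 <= (1 : R) <= 1 by rewrite ler01 lexx.
have cg (s : R) : 0 <= s <= 1 -> cvgn (series (fun j => p j * rem2 s j)).
  exact: is_cvg_rem2.
pose w k j := q k * (p j * (rem2 1 j - rem2 (1 - q k) j)).
have cwk k : cvgn (series (fun j => p j * (rem2 1 j - rem2 (1 - q k) j))).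
  have -> : (fun j => p j * (rem2 1 j - rem2 (1 - q k) j)) =
     (fun j => p j * rem2 1 j + (- 1) * (p j * rem2 (1 - q k) j)).
    by apply/funext => j; ring.
  by apply: is_cvg_sumD; [exact: cg | apply: is_cvg_sumZ; exact: cg].
have cw k : cvgn (series (w k)) by exact: is_cvg_sumZ.
have Ew k : limn (series (w k)) = q k * (half_variance - curvature (1 - q k)).
  rewrite /w sumZ //; congr (_ * _).
  have -> : (fun j => p j * (rem2 1 j - rem2 (1 - q k) j)) =
     (fun j => p j * rem2 1 j + (- 1) * (p j * rem2 (1 - q k) j)).
    by apply/funext => j; ring.
  rewrite sumD; [|exact: cg|by apply: is_cvg_sumZ; exact: cg].
  by rewrite sumZ; [rewrite mulN1r | exact: cg].
have cb : cvgn (series (fun j =>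
    2 / c ^+ 2 * (p j * j%:R ^+ 2 + p j * j%:R ^+ 2 * ln j%:R))).
  by apply: is_cvg_sumZ; exact: is_cvg_sumD.
have w0 k j : 0 <= w k j.
  have /andP[s0 s1] := q01 k.
  by rewrite /w mulr_ge0 // mulr_ge0 // subr_ge0 le_rem2.
have wS n j : \sum_(k < n) w k j <=
    2 / c ^+ 2 * (p j * j%:R ^+ 2 + p j * j%:R ^+ 2 * ln j%:R).
  case: j => [|j].
    rewrite /w /rem2 big1 => [|k _]; last by rewrite !big_ord0 subr0 !mulr0.
    by rewrite expr0n !mulr0 mul0r addr0 mulr0.
  have H k : w k j.+1 <= p j.+1 * (2 / c ^+ 2 * j.+1%:R ^+ 2) *
      (j.+1%:R / (k.+1%:R * (k.+1 + j.+1)%:R)).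
    by rewrite /w mulrCA -mulrA ler_wpM2l //; exact: rem2_gap_le.
  apply: le_trans (ler_sum _ (fun k _ => H (nat_of_ord k))) _.
  rewrite -mulr_sumr.
  have -> : 2 / c ^+ 2 * (p j.+1 * j.+1%:R ^+ 2 + p j.+1 * j.+1%:R ^+ 2 * ln j.+1%:R)
     = p j.+1 * (2 / c ^+ 2 * j.+1%:R ^+ 2) * (1 + ln j.+1%:R) by ring.
  rewrite ler_wpM2l ?telescoping_harmonic_le // mulr_ge0 // mulr_ge0 ?sqr_ge0 //.
  by rewrite divr_ge0 // sqr_ge0.
have Ew' : (fun k => q k * (half_variance - curvature (1 - q k))) = (fun k => limn (series (w k))).
  by apply/funext => k; rewrite Ew.
rewrite Ew'; apply: nondecreasing_is_cvgn.
  by apply/nondecreasing_seqP => k; rewrite seriesSr lerDl sum_ge0.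
exists (limn (series (fun j =>
    2 / c ^+ 2 * (p j * j%:R ^+ 2 + p j * j%:R ^+ 2 * ln j%:R)))) => _ [n _ <-].
rewrite /series /= big_mkord.
have [_ <-] := is_cvg_sum_big n cw.
by apply: sum_le => // j; rewrite wS andbT sumr_ge0.
Qed.

Lemma pgf_h_bounds (s : R) : 0 <= s < 1 -> h 0%N <= pgf h s <= 1.
Proof.
move=> s01; have s01' := s01W s01; have /andP[s0 s1] := s01'.
have ch' := is_cvg_pgf h0 ch s01'.
apply/andP; split.
  have t0 k : 0 <= h k * s ^+ k by rewrite mulr_ge0 // exprn_ge0.
  have := partial_le_sum 1 t0 ch'.
  by rewrite /series /= big_nat1 expr0 mulr1.
rewrite -h1; apply: sum_le => // k.
by rewrite mulr_ge0 ?exprn_ge0 //= ler_piMr // exprn_ile1.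
Qed.

(** The finite second moment of [h] controls both the expansion of [pgf h] and
    the passage to the logarithm. *)
Lemma ln_pgf_h (s : R) : 0 <= s < 1 ->
  `|ln (pgf h s) + immigration_mean * (1 - s)| <=
    (limn (series (fun k => h k * k%:R ^+ 2)) + immigration_mean ^+ 2 / h 0%N) * (1 - s) ^+ 2.
Proof.
move=> s01; have s01' := s01W s01; have /andP[s0 s1] := s01'.
have /andP[hp0 hp1] := hp.
have /andP[H0 H1] := pgf_h_bounds s01.
have cm := is_cvg_first_moment_of_second h0 ch2.
have b0 : 0 <= immigration_mean by apply: sum_ge0 => // k; rewrite mulr_ge0.
have E := pgf_expansion h0 ch cm ch2 s01'.
set rr := limn (series (fun k => h k * rem2 s k)) in E.
have r0 : 0 <= rr.
  by apply: sum_ge0 => [k|]; [rewrite mulr_ge0 // rem2_ge0 | exact: is_cvg_rem2].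
have r1 : rr <= limn (series (fun k => h k * k%:R ^+ 2)).
  by apply: sum_le => // k; rewrite mulr_ge0 ?rem2_ge0 //= ler_wpM2l // rem2_le.
have Hp : 0 < pgf h s by exact: lt_le_trans H0.
have /andP[L1 L2] := ln_quadratic Hp.
move: E; rewrite h1 -/immigration_mean => E.
have q0 : 0 <= 1 - s by lra.
have u0 : 0 <= 1 - pgf h s by lra.
have ub : 1 - pgf h s <= immigration_mean * (1 - s).
  have : 0 <= (1 - s) ^+ 2 * rr by rewrite mulr_ge0 // sqr_ge0.
  by rewrite E; lra.
have u2 : (1 - pgf h s) ^+ 2 / pgf h s <= immigration_mean ^+ 2 / h 0%N * (1 - s) ^+ 2.
  rewrite [leRHS]mulrAC -exprMn; apply: ler_pM.
  - exact: sqr_ge0.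
  - by rewrite invr_ge0 ltW.
  - by apply: lerXn2r => //; rewrite nnegrE // mulr_ge0.
  - by rewrite lef_pV2 ?posrE.
have B1 : (1 - s) ^+ 2 * rr <=
    limn (series (fun k => h k * k%:R ^+ 2)) * (1 - s) ^+ 2.
  by rewrite mulrC ler_wpM2r // sqr_ge0.
have B2 : 0 <= immigration_mean ^+ 2 / h 0%N * (1 - s) ^+ 2.
  by rewrite mulr_ge0 ?sqr_ge0 // divr_ge0 ?sqr_ge0 // ltW.
rewrite ler_norml mulrDl; apply/andP; split; lra.
Qed.

Lemma pgf_near_critical : near_critical (pgf p) (pgf h) curvature half_variance immigration_mean drift_floor
  (limn (series (fun k => h k * k%:R ^+ 2)) + immigration_mean ^+ 2 / h 0%N).
Proof.
have /andP[pp0 pp1] := pp; have /andP[hp0 hp1] := hp.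
have cp' : drift_floor <= p 0%N by rewrite ge_min lexx.
have cp1 : drift_floor <= 1 - p 0%N by rewrite ge_min lexx orbT.
have c01 : 0 < drift_floor <= 1.
  by rewrite lt_min pp0 subr_gt0 pp1 /=; apply: (le_trans cp'); lra.
split => //.
- by move=> s s01; exact: pgf_p_expansion (s01W s01).
- move=> s s01; have /andP[s0 s1] := s01.
  have := pgf_p_le (s01W s01).
  have : drift_floor * (1 - s) <= (1 - p 0%N) * (1 - s) by rewrite ler_wpM2r //; lra.
  by lra.
- move=> s /andP[s0 s1]; apply/andP; split.
    by apply: (le_trans cp'); rewrite -curvature0; apply: le_curvature => //; exact: ltW.
  have -> : half_variance = curvature 1 by [].
  by apply: le_curvature => //; exact: ltW.
- by move=> s t s0 st t1; apply: le_curvature => //; exact: ltW.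
- exact: curvature_lim.
- exact: is_cvg_gap.
- move=> s s01; have /andP[H0 ->] := pgf_h_bounds s01.
  by rewrite (lt_le_trans hp0 H0).
- exact: ln_pgf_h.
Qed.

End NearCritical.

(** * Iterates near the fixed point *)
Section Iterates.
Context {R : realType} (f h g : R -> R) (gam beta c B : R).
Hypothesis nc : near_critical f h g gam beta c B.
Hypothesis beta0 : 0 <= beta.

Let sigma := beta / gam.

Let c0 : 0 < c. Proof. by have /andP[] := nc_c nc. Qed.

Let g_bounds s : 0 <= s < 1 -> c <= g s /\ g s <= gam.
Proof. by move=> /(nc_g nc)/andP[]. Qed.

Let gam0 : 0 < gam.
Proof.
by have [] := @g_bounds 0 _; [rewrite lexx ltr01 | have := c0; lra].
Qed.

Let sigma0 : 0 <= sigma. Proof. by rewrite divr_ge0 // ltW. Qed.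

Let beta_sigma : beta = sigma * gam.
Proof. by rewrite /sigma divfK // gt_eqF. Qed.

Lemma f_stable s : 0 <= s < 1 -> 0 <= f s < 1.
Proof.
move=> s01; have /andP[s0 s1] := s01.
have [g1 g2] := g_bounds s01; have l1 := nc_f_lt1 nc s01.
apply/andP; split; last by have : 0 < c * (1 - s); [rewrite mulr_gt0 // subr_gt0 | lra].
rewrite (nc_f nc s01) addr_ge0 // mulr_ge0 ?sqr_ge0 //.
by have := c0; lra.
Qed.

Lemma le_f s : 0 <= s < 1 -> s <= f s.
Proof.
move=> s01; have [g1 g2] := g_bounds s01.
by rewrite (nc_f nc s01) lerDl mulr_ge0 ?sqr_ge0 //; have := c0; lra.
Qed.

Lemma iter_stable k s : 0 <= s < 1 -> 0 <= iter k f s < 1.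
Proof. by move=> s01; elim: k => // k IH; exact: f_stable. Qed.

Lemma le_iter k s : 0 <= s < 1 -> s <= iter k f s.
Proof.
move=> s01; elim: k => // k IH; apply: (le_trans IH).
exact: le_f (iter_stable k s01).
Qed.

(** In the coordinate [(1 - s)^-1], which sends the fixed point 1 to infinity,
    [f] is nearly the translation by [gam]; [drift] is the actual step. *)
Definition drift s : R := (1 - f s)^-1 - (1 - s)^-1.

Let quot s : 0 <= s < 1 -> c <= 1 - (1 - s) * g s /\
  1 - f s = (1 - s) * (1 - (1 - s) * g s).
Proof.
move=> s01; have /andP[s0 s1] := s01.
have E : 1 - f s = (1 - s) * (1 - (1 - s) * g s) by rewrite (nc_f nc s01); ring.
split => //; have := nc_f_lt1 nc s01; rewrite E mulrC ler_pM2l //; lra.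
Qed.

Let driftE s : 0 <= s < 1 -> drift s = g s / (1 - (1 - s) * g s).
Proof.
move=> s01; have /andP[s0 s1] := s01; have [H E] := quot s01.
have F (q G : R) : q != 0 -> 1 - q * G != 0 ->
    (q * (1 - q * G))^-1 - q^-1 = G / (1 - q * G).
  by move=> q0 G0; field; rewrite q0 G0.
by rewrite /drift E F // gt_eqF //; have := c0; lra.
Qed.

Lemma drift_ge s : 0 <= s < 1 -> c <= drift s.
Proof.
move=> s01; have /andP[s0 s1] := s01; have [H E] := quot s01.
have [g1 g2] := g_bounds s01.
have gs0 : 0 <= g s by have := c0; lra.
have d0 : 0 < 1 - (1 - s) * g s by have := c0; lra.
rewrite driftE // ler_pdivlMr //; apply: le_trans g1.
by rewrite ler_piMr ?(ltW c0) // lerBlDr lerDl mulr_ge0 //; lra.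
Qed.

Definition drift_error s : R := (gam - g s + gam ^+ 2 * (1 - s)) / c.

(** From $1 - f(s) = q (1 - q g(s))$ with $q = 1 - s$ the step equals
    $g(s) / (1 - q g(s))$, and the denominator is at least [c]. *)
Lemma drift_near_gam s : 0 <= s < 1 -> `|drift s - gam| <= drift_error s.
Proof.
move=> s01; have /andP[s0 s1] := s01; have [H E] := quot s01.
have [g1 g2] := g_bounds s01.
have gs0 : 0 <= g s by have := c0; lra.
have d0 : 0 < 1 - (1 - s) * g s by have := c0; lra.
have -> : drift s - gam = (g s - gam + gam * (1 - s) * g s) / (1 - (1 - s) * g s).
  by rewrite driftE //; field; rewrite gt_eqF.
rewrite normrM normfV (ger0_norm (ltW d0)).
apply: ler_pM; [by []|by rewrite invr_ge0 ltW| |by rewrite lef_pV2 ?posrE].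
apply: le_trans (ler_normD _ _) _.
apply: lerD; first by rewrite ler0_norm; lra.
rewrite ger0_norm; last by rewrite !mulr_ge0 // ?ltW // subr_gt0.
rewrite expr2 mulrAC -!mulrA ler_wpM2l ?(ltW gam0) // ler_wpM2r //; lra.
Qed.

Lemma drift_error_ge0 s : 0 <= s < 1 -> 0 <= drift_error s.
Proof. by move=> s01; apply: le_trans (drift_near_gam s01). Qed.

Lemma le_drift_error s t : 0 <= s -> s <= t -> t < 1 ->
  drift_error t <= drift_error s.
Proof.
move=> s0 st t1; have gst := nc_g_mono nc s0 st t1.
rewrite /drift_error ler_wpM2r ?invr_ge0 ?(ltW c0) //.
have : gam ^+ 2 * (1 - t) <= gam ^+ 2 * (1 - s).
  by rewrite ler_wpM2l ?sqr_ge0 //; lra.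
by lra.
Qed.

Lemma drift_error_lim : drift_error s @[s --> (1 : R)^'-] --> (0 : R).
Proof.
have -> : (0 : R) = (gam - gam + gam ^+ 2 * (1 - 1)) / c by rewrite !subrr mulr0 addr0 mul0r.
apply: cvgM; last exact: cvg_cst.
apply: cvgD; first by apply: cvgB; [exact: cvg_cst | exact: nc_g_lim nc].
apply: cvgM; first exact: cvg_cst.
by apply: cvgB; [exact: cvg_cst | exact: cvg_at_left_filter].
Qed.

(** The distance of the orbit to 1, inverted and normalized to start at 1. *)
Definition expansion n s : R := (1 - s) / (1 - iter n f s).

Lemma expansionE n s : 0 <= s < 1 ->
  expansion n s = 1 + (1 - s) * \sum_(k < n) drift (iter k f s).
Proof.
move=> s01; have /andP[s0 s1] := s01.
have q0 : 1 - s != 0 by rewrite subr_eq0 gt_eqF.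
elim: n => [|n IH]; first by rewrite /expansion /= divff // big_ord0 mulr0 addr0.
rewrite big_ord_recr /= mulrDr addrA -IH /drift /expansion /=; ring.
Qed.

Lemma expansion_ge n s : 0 <= s < 1 ->
  1 + c * n%:R * (1 - s) <= expansion n s.
Proof.
move=> s01; have /andP[s0 s1] := s01; rewrite expansionE //.
rewrite lerD2l mulrC ler_wpM2l ?subr_ge0 ?(ltW s1) //.
have -> : c * n%:R = \sum_(k < n) c by rewrite sumr_const card_ord mulr_natr.
by apply: ler_sum => k _; exact: drift_ge (iter_stable k s01).
Qed.

Lemma expansion_gt0 n s : 0 <= s < 1 -> 0 < expansion n s.
Proof.
move=> s01; have /andP[s0 s1] := s01.
have /andP[i0 i1] := iter_stable n s01.
by rewrite divr_gt0 // subr_gt0.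
Qed.

Lemma expansion_error n s : 0 <= s < 1 ->
  `|expansion n s - (1 + gam * n%:R * (1 - s))| <=
    n%:R * (1 - s) * drift_error s.
Proof.
move=> s01; have /andP[s0 s1] := s01; rewrite expansionE //.
have -> : 1 + (1 - s) * \sum_(k < n) drift (iter k f s) - (1 + gam * n%:R * (1 - s))
    = (1 - s) * \sum_(k < n) (drift (iter k f s) - gam).
  by rewrite [in RHS]sumrB sumr_const card_ord -mulr_natr; ring.
rewrite normrM ger0_norm ?subr_ge0 ?(ltW s1) // -mulrA mulrCA.
rewrite ler_wpM2l ?subr_ge0 ?(ltW s1) //.
apply: le_trans (ler_norm_sum _ _ _) _.
have -> : n%:R * drift_error s = \sum_(k < n) drift_error s.
  by rewrite sumr_const card_ord mulr_natl.
apply: ler_sum => k _.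
apply: le_trans (drift_near_gam (iter_stable k s01)) _.
by apply: le_drift_error => //; [exact: le_iter | have /andP[] := iter_stable k s01].
Qed.

(** Every step is at least [c], so the orbit stays ahead of one that moves by
    exactly [c] per step. *)
Lemma iter_ge n s : 0 <= s < 1 -> forall K : nat,
  1 - (1 + c * K%:R)^-1 <= s ->
  1 - (1 + c * (K + n)%:R)^-1 <= iter n f s.
Proof.
move=> s01 K sK; have /andP[s0 s1] := s01.
have /andP[i0 i1] := iter_stable n s01.
have q0 : 0 < 1 - s by rewrite subr_gt0.
have cK0 : 0 < 1 + c * K%:R by rewrite ltr_wpDr // mulr_ge0 // ltW.
have cKn0 : 0 < 1 + c * (K + n)%:R by rewrite ltr_wpDr // mulr_ge0 // ltW.
have qK : 1 + c * K%:R <= (1 - s)^-1.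
  by rewrite -[leLHS]invrK lef_pV2 ?posrE ?invr_gt0 //; lra.
have : 1 + c * (K + n)%:R <= (1 - iter n f s)^-1.
  apply: (@le_trans _ _ ((1 - s)^-1 * expansion n s)); last first.
    by rewrite /expansion mulKf // gt_eqF.
  apply: (@le_trans _ _ ((1 - s)^-1 * (1 + c * n%:R * (1 - s)))).
    rewrite mulrDr mulr1 mulrCA mulVf ?gt_eqF // mulr1 natrD; lra.
  by rewrite ler_wpM2l ?invr_ge0 ?(ltW q0) // expansion_ge.
rewrite -[leLHS]invrK lef_pV2 ?posrE ?invr_gt0 //; lra.
Qed.

(** The logarithm of one step of the product $\prod_k h(f_k(s))$, corrected by
    the power of the distance to 1 that compensates it to first order. *)
Definition defect s : R := sigma * ln ((1 - s) / (1 - f s)) + ln (h s).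

Definition defect_bound s : R :=
  sigma * ((1 - s) * (gam - g s)) +
  (sigma * gam ^+ 2 / c + `|B|) * (1 - s) ^+ 2.

(** Both logarithms are expanded to second order.  Because [beta = sigma * gam],
    the terms of order [1 - s] cancel up to [gam - g s]. *)
Lemma defect_le s : 0 <= s < 1 -> `|defect s| <= defect_bound s.
Proof.
move=> s01; have /andP[s0 s1] := s01; have [H E] := quot s01.
have [g1 g2] := g_bounds s01.
have gs0 : 0 <= g s by have := c0; lra.
have q0 : 0 < 1 - s by rewrite subr_gt0.
set y := 1 - (1 - s) * g s in H E *.
have y0 : 0 < y by have := c0; lra.
have -> : defect s = - (sigma * ln y) + ln (h s).
  rewrite /defect E; congr (_ + _); rewrite -mulrN -lnV //; congr (_ * ln _).
  by field; rewrite !gt_eqF.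
have /andP[L1 L2] := ln_quadratic y0.
have M1 := ler_wpM2l sigma0 L1; have M2 := ler_wpM2l sigma0 L2.
have := nc_ln_h nc s01; rewrite ler_norml => /andP[N1 N2].
have B2 : B * (1 - s) ^+ 2 <= `|B| * (1 - s) ^+ 2.
  by rewrite ler_wpM2r ?sqr_ge0 // ler_norm.
have Q : sigma * ((1 - y) ^+ 2 / y) <= sigma * gam ^+ 2 / c * (1 - s) ^+ 2.
  have -> : sigma * gam ^+ 2 / c * (1 - s) ^+ 2 =
    sigma * (((1 - s) * gam) ^+ 2 / c) by ring.
  rewrite ler_wpM2l //.
  apply: ler_pM; rewrite ?sqr_ge0 // ?invr_ge0 ?(ltW y0) //.
    have -> : 1 - y = (1 - s) * g s by rewrite /y; ring.
    apply: lerXn2r; rewrite ?nnegrE ?mulr_ge0 ?(ltW gam0) ?(ltW q0) //.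
    by rewrite ler_wpM2l // ltW.
  by rewrite lef_pV2 ?posrE.
have P0 : 0 <= sigma * ((1 - s) * (gam - g s)).
  by apply: mulr_ge0 => //; apply: mulr_ge0; lra.
have Q0 : 0 <= sigma * gam ^+ 2 / c * (1 - s) ^+ 2.
  by rewrite mulr_ge0 ?sqr_ge0 // divr_ge0 ?(ltW c0) // mulr_ge0 ?sqr_ge0.
have E1 : sigma * (y - 1) + beta * (1 - s) = sigma * ((1 - s) * (gam - g s)).
  by rewrite beta_sigma /y; ring.
rewrite /defect_bound mulrDl ler_norml.
move: M1; rewrite mulrBr => M1.
by apply/andP; split; lra.
Qed.

Lemma le_defect_bound s t : 0 <= s -> s <= t -> t < 1 ->
  defect_bound t <= defect_bound s.
Proof.
move=> s0 st t1; have gst := nc_g_mono nc s0 st t1.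
have s01 : 0 <= s < 1 by rewrite s0 (le_lt_trans st).
have t01 : 0 <= t < 1 by rewrite (le_trans s0).
have [_ gt] := g_bounds t01; have [_ gs] := g_bounds s01.
apply: lerD; first by rewrite ler_wpM2l // ler_pM //; lra.
rewrite ler_wpM2l //; last by apply: lerXn2r; rewrite ?nnegrE; lra.
by rewrite addr_ge0 // divr_ge0 ?(ltW c0) // mulr_ge0 ?sqr_ge0.
Qed.

Lemma defect_bound_ge0 s : 0 <= s < 1 -> 0 <= defect_bound s.
Proof. by move=> s01; apply: le_trans (defect_le s01). Qed.

Let q k : R := (1 + c * k%:R)^-1.

Let q01 k : 0 <= 1 - q k < 1.
Proof.
have ck : 1 <= 1 + c * k%:R by rewrite lerDl mulr_ge0 // ltW.
have k0 := lt_le_trans ltr01 ck.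
by rewrite subr_ge0 /q invf_le1 // ck /= ltrBlDr ltrDl invr_gt0.
Qed.

Let v k : R := defect_bound (1 - q k).

Let v0 k : 0 <= v k. Proof. exact: defect_bound_ge0. Qed.

Lemma is_cvg_defect_bounds : cvgn (series v).
Proof.
have cq2 : cvgn (series (fun k => q k ^+ 2)).
  apply: nondecreasing_is_cvgn.
    by apply/nondecreasing_seqP => k; rewrite seriesSr lerDl sqr_ge0.
  exists (2 / c ^+ 2 * (1 + ln 1%:R)) => _ [n _ <-].
  rewrite /series /= big_mkord.
  apply: (le_trans _ (ler_wpM2l _ (telescoping_harmonic_le n (ltn0Sn 0)))); last first.
    by rewrite divr_ge0 // sqr_ge0.
  rewrite mulr_sumr; apply: ler_sum => k _.
  have k0 : (0 : R) < k.+1%:R by rewrite ltr0n.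
  have ck : c * k.+1%:R <= 1 + c * k%:R.
    by rewrite -natr1 mulrDr mulr1; have /andP[] := nc_c nc; lra.
  have ck0 : 0 < c * k.+1%:R by rewrite mulr_gt0.
  apply: (@le_trans _ _ ((c * k.+1%:R)^-1 ^+ 2)).
    apply: lerXn2r; rewrite ?nnegrE ?invr_ge0 ?(ltW ck0) //.
      by rewrite ltW // (lt_le_trans ck0).
    by rewrite lef_pV2 ?posrE // (lt_le_trans ck0).
  rewrite natrD; move: (k.+1%:R : R) k0 (@ler1n R k.+1) => x x0 x1.
  have {}x1 : 1 <= x by rewrite x1.
  have -> : 2 / c ^+ 2 * (1%:R / (x * (x + 1%:R))) = (c * x)^-1 ^+ 2 * (2 * x / (x + 1)).
    by field; rewrite !gt_eqF // ltr_wpDr.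
  rewrite ler_peMr ?sqr_ge0 // ler_pdivlMr; lra.
have -> : v = (fun k => sigma * (q k * (gam - g (1 - q k))) +
    (sigma * gam ^+ 2 / c + `|B|) * q k ^+ 2).
  by apply/funext => k; rewrite /v /defect_bound subKr.
exact: (is_cvg_sumD (is_cvg_sumZ sigma (nc_sum nc)) (is_cvg_sumZ _ cq2)).
Qed.

Definition total_defect n s : R := \sum_(k < n) defect (iter k f s).

Let defect_iter_le k s (K : nat) : 0 <= s < 1 -> 1 - q K <= s ->
  `|defect (iter k f s)| <= v (K + k).
Proof.
move=> s01 sK; apply: le_trans (defect_le (iter_stable k s01)) _.
have /andP[q0 _] := q01 (K + k)%N; apply: le_defect_bound => //.
  exact: iter_ge.
by have /andP[] := iter_stable k s01.
Qed.

(** The iterates of [s] stay ahead of the points [1 - q (K + k)], and the bound on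
    the defect decreases along the way to 1. *)
Lemma total_defect_tail n s (K : nat) : 0 <= s < 1 -> 1 - q K <= s ->
  `|total_defect n s| <= limn (series v) - series v K.
Proof.
move=> s01 sK; apply: le_trans (ler_norm_sum _ _ _) _.
apply: (@le_trans _ _ (\sum_(k < n) v (K + k))).
  by apply: ler_sum => k _; exact: defect_iter_le.
rewrite lerBrDr; apply: le_trans (partial_le_sum (K + n) v0 is_cvg_defect_bounds).
by rewrite /series /= !big_mkord big_split_ord /= addrC.
Qed.

Let q0E : 1 - q 0 = 0. Proof. by rewrite /q mulr0 addr0 invr1 subrr. Qed.

Lemma total_defect_bounded : exists M : R, forall n s, 0 <= s < 1 ->
  `|total_defect n s| <= M.
Proof.
exists (limn (series v) - series v 0) => n s s01; apply: total_defect_tail => //.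
by rewrite q0E; have /andP[] := s01.
Qed.

Lemma total_defect_small (e : R) : 0 < e ->
  \forall s \near (1 : R)^'-, forall n, `|total_defect n s| <= e.
Proof.
move=> e0; have /cvgrPdist_le/(_ _ e0)[K _ HK] := is_cvg_defect_bounds.
have {}HK : limn (series v) - series v K <= e.
  by apply: le_trans (HK K _) => //=; exact: ler_norm.
have /andP[qK0 qK1] := q01 K.
near=> s => n; apply: le_trans HK; apply: total_defect_tail.
  by apply/andP; split; near: s; [exact: nbhs_left_ge | exact: nbhs_left_lt].
by near: s; exact: nbhs_left_ge.
Unshelve. all: by end_near.
Qed.

Lemma is_cvg_total_defect s : 0 <= s < 1 -> cvgn (total_defect ^~ s).
Proof.
move=> s01.
have -> : total_defect ^~ s = series (fun k => defect (iter k f s)).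
  by apply/funext => n; rewrite /series /= big_mkord.
apply: normed_cvg; apply: (is_cvg_series_le _ is_cvg_defect_bounds) => k.
rewrite normr_ge0 /=; apply: (@defect_iter_le k s 0%N) => //.
by rewrite q0E; have /andP[] := s01.
Qed.

Definition hprod n s : R := \prod_(k < n) h (iter k f s).

(** The logarithms of the successive distances to 1 telescope. *)
Lemma hprodE n s : 0 <= s < 1 ->
  hprod n s = expR (total_defect n s - sigma * ln (expansion n s)).
Proof.
move=> s01; have /andP[s0 s1] := s01.
have q0 : 1 - s != 0 by rewrite subr_eq0 gt_eqF.
elim: n => [|n IH].
  by rewrite /hprod /total_defect /expansion /= !big_ord0 divff // ln1 mulr0 subrr expR0.
rewrite /hprod /total_defect !big_ord_recr /= -/(hprod n s) -/(total_defect n s) IH.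
have i01 := iter_stable n s01; have i01' := iter_stable n.+1 s01.
have /andP[i0 i1] := i01; have /andP[j0 j1] := i01'.
have /andP[h0 h1] := nc_h nc i01.
rewrite -{1}(lnK h0) -expRD; congr (expR _).
rewrite /defect.
have -> : expansion n.+1 s = expansion n s * ((1 - iter n f s) / (1 - iter n.+1 f s)).
  rewrite /expansion; field.
  by rewrite !subr_eq0 !gt_eqF.
rewrite lnM ?posrE ?expansion_gt0 ?divr_gt0 ?subr_gt0 //=; ring.
Qed.

Lemma hprod_le : exists C : R, 0 < C /\ forall n s, (0 < n)%N -> 0 <= s < 1 ->
  hprod n s <= C * (n%:R * (1 - s)) `^ (- sigma).
Proof.
have [M HM] := total_defect_bounded.
exists (expR M * c `^ (- sigma)); split; first by rewrite mulr_gt0 ?expR_gt0 // powR_gt0.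
move=> n s n0 s01; have /andP[s0 s1] := s01; rewrite hprodE // expRD.
have nq0 : 0 < n%:R * (1 - s) by rewrite mulr_gt0 ?ltr0n ?subr_gt0.
rewrite -mulrA -powRM ?(ltW c0) ?(ltW nq0) //.
apply: ler_pM; rewrite ?expR_ge0 //.
  by rewrite ler_expR; apply: le_trans (HM n s s01); exact: ler_norm.
have cn0 : 0 < c * (n%:R * (1 - s)) by rewrite mulr_gt0.
rewrite /powR gt_eqF // ler_expR -mulNr ler_wnM2l ?oppr_le0 //.
rewrite ler_ln ?posrE ?expansion_gt0 //.
by apply: le_trans (expansion_ge n s01); rewrite -mulrA; lra.
Qed.

Lemma iter_cvg1 s : 0 <= s < 1 -> iter n f s @[n --> \oo] --> (1 : R)^'-.
Proof.
move=> s01.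
have lim1 : iter n f s @[n --> \oo] --> (1 : R).
  apply/cvgrPdist_le => e e0.
  near=> n; have /andP[i0 i1] := iter_stable n s01.
  rewrite ger0_norm ?subr_ge0 ?(ltW i1) //.
  have := @iter_ge n s s01 0%N; rewrite -/(q 0) q0E add0n => /(_ (proj1 (andP s01))).
  have : (1 + c * n%:R)^-1 <= e.
    have ne : (e * c)^-1 <= n%:R by near: n; exact: nbhs_infty_ger.
    have n0 : 0 < 1 + c * n%:R by rewrite ltr_wpDr // mulr_ge0 // ltW.
    rewrite -[leRHS]invrK lef_pV2 ?posrE ?invr_gt0 //.
    have : c * (e * c)^-1 <= c * n%:R by rewrite ler_wpM2l // ltW.
    rewrite invfM mulrCA divff ?gt_eqF // mulr1; lra.
  by lra.
move=> A A1; change (\forall n \near \oo, A (iter n f s)).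
near=> n; have /andP[_ i1] := iter_stable n s01.
suff : iter n f s < 1 -> A (iter n f s) by apply.
near: n; exact: (lim1 _ A1).
Unshelve. all: by end_near.
Qed.

(** The steps converge to [gam] along the orbit, hence so do their averages. *)
Lemma expansion_lim s : 0 <= s < 1 ->
  expansion n.+1 s / n.+1%:R @[n --> \oo] --> (1 - s) * gam.
Proof.
move=> s01.
have dlim : drift (iter n f s) @[n --> \oo] --> gam.
  apply/cvgrPdist_le => e e0.
  have : \forall t \near (1 : R)^'-, drift_error t <= e.
    have /cvgrPdist_le/(_ _ e0) := drift_error_lim.
    by apply: filterS => t; rewrite sub0r normrN; apply: le_trans; exact: ler_norm.
  move=> /(iter_cvg1 s01) He; near=> n.
  rewrite distrC; apply: le_trans (drift_near_gam (iter_stable n s01)) _.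
  by near: n.
have E : (fun n => expansion n.+1 s / n.+1%:R) =
    (fun n => n.+1%:R^-1 + (1 - s) * arithmetic_mean (fun k => drift (iter k f s)) n).
  apply/funext => n; rewrite expansionE // /arithmetic_mean /series /= big_mkord; ring.
rewrite E -[X in _ --> X]add0r; apply: cvgD; first exact: cvg_harmonic.
by apply: cvgM; [exact: cvg_cst | exact: cesaro].
Unshelve. all: by end_near.
Qed.

Lemma is_cvg_hprod s : 0 <= s < 1 ->
  cvgn (fun n => n%:R `^ sigma * hprod n s).
Proof.
move=> s01; have /andP[s0 s1] := s01.
have /cvg_ex[/= l Hl] := is_cvg_total_defect s01.
have lg0 : 0 < (1 - s) * gam by rewrite mulr_gt0 // subr_gt0.
apply/cvg_ex; exists (expR (l - sigma * ln ((1 - s) * gam))).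
rewrite -cvg_shiftS.
have E : (fun n => n.+1%:R `^ sigma * hprod n.+1 s) = (fun n =>
    expR (total_defect n.+1 s - sigma * ln (expansion n.+1 s / n.+1%:R))).
  apply/funext => n; rewrite hprodE // ln_div ?posrE ?expansion_gt0 ?ltr0n //.
  rewrite /powR pnatr_eq0 /= -expRD; congr (expR _); ring.
rewrite E; apply: continuous_cvg; first exact: continuous_expR.
apply: cvgB; first by rewrite (cvg_shiftS (total_defect ^~ s)).
apply: cvgM; first exact: cvg_cst.
by apply: continuous_cvg; [exact: continuous_ln | exact: expansion_lim].
Qed.

(** When the starting point itself tends to 1 the total defect vanishes, uniformly
    in the number of steps, and only the expansion factor remains. *)
Lemma hprod_diagonal (t : nat -> R) : (forall n, 0 < t n) ->
  t n @[n --> \oo] --> (0 : R) ->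
  hprod n (expR (- t n)) * (1 + gam * n%:R * t n) `^ sigma @[n --> \oo] -->
    (1 : R).
Proof.
move=> t0 tlim; set s := fun n => expR (- t n).
have s01 n : 0 <= s n < 1 by rewrite expR_ge0 expR_lt1 oppr_lt0 t0.
have slim : s n @[n --> \oo] --> (1 : R)^'-.
  have s1 : s n @[n --> \oo] --> (1 : R).
    have : expR (- t n) @[n --> \oo] --> expR (- 0).
      by apply: continuous_cvg; [exact: continuous_expR | exact: cvgN].
    by rewrite oppr0 expR0.
  move=> A A1; change (\forall n \near \oo, A (s n)); near=> n.
  suff : s n < 1 -> A (s n) by apply; have /andP[] := s01 n.
  near: n; exact: (s1 _ A1).
have qt n : 1 - s n <= t n by have := expR_ge1Dx (- t n); rewrite /s; lra.
have tq n : t n - (1 - s n) <= t n * t n.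
  have /andP[sn0 _] := s01 n.
  have : t n * s n <= 1 - s n.
    have /(ler_wpM2r sn0) := expR_ge1Dx (t n).
    by rewrite /s -expRD addrN expR0; lra.
  by have := qt n; have := t0 n; nra.
pose x n := 1 + gam * n%:R * t n.
have x1 n : 1 <= x n by rewrite lerDl !mulr_ge0 // ltW.
have x0 n : 0 < x n by exact: lt_le_trans (x1 n).
have ratio_error n : `|expansion n (s n) / x n - 1| <=
    (drift_error (s n) + gam * t n) / gam.
  have -> : expansion n (s n) / x n - 1 = (expansion n (s n) - x n) / x n.
    by field; rewrite gt_eqF.
  rewrite normrM normfV (ger0_norm (ltW (x0 n))) ler_pdivrMr //.
  have D0 := drift_error_ge0 (s01 n).
  apply: (@le_trans _ _ (n%:R * t n * (drift_error (s n) + gam * t n))).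
    have -> : expansion n (s n) - x n =
        (expansion n (s n) - (1 + gam * n%:R * (1 - s n))) -
        gam * n%:R * (t n - (1 - s n)) by rewrite /x; ring.
    apply: le_trans (ler_normB _ _) _; rewrite [leRHS]mulrDr; apply: lerD.
      apply: le_trans (expansion_error n (s01 n)) _.
      by rewrite ler_wpM2r // ler_wpM2l.
    rewrite ger0_norm; last by rewrite !mulr_ge0 ?subr_ge0 // ltW.
    have : gam * n%:R * (t n - (1 - s n)) <= gam * n%:R * (t n * t n).
      by rewrite ler_wpM2l // mulr_ge0 // ltW.
    lra.
  have E0 : 0 <= drift_error (s n) + gam * t n.
    by rewrite addr_ge0 // mulr_ge0 // ltW.
  have -> : n%:R * t n * (drift_error (s n) + gam * t n) =
      (drift_error (s n) + gam * t n) / gam * (gam * n%:R * t n).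
    by field; rewrite gt_eqF.
  by rewrite ler_wpM2l ?divr_ge0 ?(ltW gam0) // /x; lra.
have ratio_lim : expansion n (s n) / x n @[n --> \oo] --> (1 : R).
  apply/cvgrPdist_le => e e0; near=> n; rewrite distrC.
  apply: le_trans (ratio_error n) _; near: n.
  have : (drift_error (s n) + gam * t n) / gam @[n --> \oo] --> (0 : R).
    have -> : (0 : R) = (0 + gam * 0) / gam by rewrite mulr0 addr0 mul0r.
    apply: cvgM; last exact: cvg_cst.
    apply: cvgD; last by apply: cvgM; [exact: cvg_cst |].
    exact: (cvg_comp _ _ slim drift_error_lim).
  move=> /cvgrPdist_le/(_ _ e0); apply: filterS => n.
  by rewrite sub0r normrN; apply: le_trans; exact: ler_norm.
have defect_lim : total_defect n (s n) @[n --> \oo] --> (0 : R).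
  apply/cvgrPdist_le => e e0.
  have : \forall n \near \oo, forall m, `|total_defect m (s n)| <= e.
    exact: (slim _ (total_defect_small e0)).
  by apply: filterS => n Hn; rewrite sub0r normrN.
have E : (fun n => hprod n (expR (- t n)) * (1 + gam * n%:R * t n) `^ sigma) =
    (fun n => expR (total_defect n (s n) - sigma * ln (expansion n (s n) / x n))).
  apply/funext => n; rewrite (hprodE _ (s01 n)) ln_div ?posrE ?expansion_gt0 //.
  rewrite -/(x n) /powR gt_eqF // -expRD; congr (expR _); rewrite /s; ring.
have : expR (total_defect n (s n) - sigma * ln (expansion n (s n) / x n))
    @[n --> \oo] --> expR (0 - sigma * ln 1); last first.
  by rewrite ln1 mulr0 subr0 expR0 E.
apply: continuous_cvg; first exact: continuous_expR.
apply: cvgB => //; apply: cvgM; first exact: cvg_cst.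
by apply: continuous_cvg => //; exact: continuous_ln.
Unshelve. all: by end_near.
Qed.

End Iterates.

(** * The Gamma integral on the half-line *)
Section Exhaustion.
Context d (T : measurableType d) (R : realType).
Variable mu : {measure set T -> \bar R}.

Lemma cvg_integral_exhaustion (D : set T) (F : nat -> set T) (f : T -> \bar R) :
  measurable D -> (forall n, measurable (F n)) -> (forall n, F n `<=` D) ->
  (forall n m, (n <= m)%N -> F n `<=` F m) ->
  (forall x, D x -> exists n, F n x) ->
  measurable_fun D f -> (forall x, D x -> (0 <= f x)%E) ->
  (\int[mu]_(x in F n) f x)%E @[n --> \oo] --> (\int[mu]_(x in D) f x)%E.
Proof.
move=> mD mF FD homoF covF mf f0.
have E n : (\int[mu]_(x in F n) f x = \int[mu]_(x in D) (f \_ (F n)) x)%E.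
  by rewrite -integral_mkcondr; congr (integral _ _ _); apply/esym/setIidPr.
under eq_fun do rewrite E.
have lim_f x : D x -> limn (fun n => (f \_ (F n)) x) = f x.
  move=> Dx; have [N FN] := covF x Dx.
  apply: cvg_lim => //; apply: cvg_near_cst; exists N => // n /= Nn.
  by rewrite patchE mem_set //; exact: homoF FN.
have -> : (\int[mu]_(x in D) f x =
    \int[mu]_(x in D) limn (fun n => (f \_ (F n)) x))%E.
  by apply: eq_integral => x /[!inE] Dx; rewrite lim_f.
apply: cvg_monotone_convergence => //.
- move=> n; apply/(measurable_restrict _ (mF n) mD).
  by apply: measurable_funS mf => //; exact: subIsetl.
- by move=> n x Dx; rewrite patchE; case: ifP => // _; exact: f0.
- move=> x Dx n m nm; rewrite !patchE; case: ifPn => [xn|_].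
    by rewrite mem_set //; apply: homoF nm _ _; exact: set_mem.
  by case: ifPn => // _; exact: f0.
Qed.

End Exhaustion.

Section HalfLineIntegrals.
Context {R : realType}.
Local Notation mu := (@lebesgue_measure R).
Local Notation halfline := (`]0, +oo[%classic : set R).

Lemma continuous_powR (p x : R) : 0 < x -> {for x, continuous (@powR R ^~ p)}.
Proof.
move=> x0.
have /derivable1_diffP/differentiable_continuous : derivable (@powR R ^~ p) x 1.
  by apply: derivable_powR; rewrite in_itv /= x0.
exact.
Qed.

Lemma measurable_powRl (p : R) (D : set R) :
  measurable_fun D (@powR R ^~ p).
Proof. by apply: measurable_funTS; exact: measurable_powR. Qed.

Lemma exists_invr_le (t : R) : 0 < t -> exists n : nat, n.+2%:R^-1 <= t.
Proof.
move=> t0; exists (Num.bound t^-1).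
rewrite -[leRHS]invrK lef_pV2 ?posrE ?ltr0n ?invr_gt0 //.
apply: le_trans (ltW (archi_boundP _)) _; first by rewrite invr_ge0 ltW.
by rewrite ler_nat; apply/leqW/leqnSn.
Qed.

Lemma integral_powR_01 (a : R) : 0 < a ->
  (\int[mu]_(t in `]0%R, 1%R]) (t `^ (a - 1))%:E <= (a^-1)%:E)%E.
Proof.
move=> a0.
pose F (n : nat) : set R := `[n.+2%:R^-1, 1]%classic.
have n0 n : (0 : R) < n.+2%:R^-1 by rewrite invr_gt0 ltr0n.
have n1 n : (n.+2%:R^-1 : R) < 1 by rewrite invf_lt1 ?ltr0n // ltr1n.
have lim : (\int[mu]_(t in F n) (t `^ (a - 1))%:E)%E @[n --> \oo] -->
    (\int[mu]_(t in `]0%R, 1%R]) (t `^ (a - 1))%:E)%E.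
  apply: cvg_integral_exhaustion.
  - exact: measurable_itv.
  - by move=> n; exact: measurable_itv.
  - by move=> n t; rewrite /F /= !in_itv /= => /andP[t0 ->]; rewrite (lt_le_trans (n0 n)).
  - move=> n m nm t; rewrite /F /= !in_itv /= => /andP[t0 ->]; rewrite andbT.
    by apply: le_trans t0; rewrite lef_pV2 ?posrE ?ltr0n // ler_nat.
  - move=> t /=; rewrite in_itv /= => /andP[t0 t1].
    by have [n Hn] := exists_invr_le t0; exists n; rewrite /F /= in_itv /= Hn.
  - by apply/measurable_EFinP; exact: measurable_powRl.
  - by move=> t _; rewrite lee_fin powR_ge0.
apply: (cvge_to_le lim); apply: nearW => n.
rewrite /F (@continuous_FTC2 _ _ (fun t => a^-1 * t `^ a)) //.
- rewrite powR1 mulr1 -EFinB lee_fin gerBl mulr_ge0 ?powR_ge0 // invr_ge0 ltW //.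
- apply: continuous_in_subspaceT => t /[!inE] /=; rewrite in_itv /= => /andP[t0 _].
  by apply: continuous_powR; exact: lt_le_trans t0.
- have cF t : 0 < t -> {for t, continuous (fun t => a^-1 * t `^ a)}.
    by move=> t0; apply: cvgM; [exact: cvg_cst | exact: continuous_powR].
  split.
  + move=> t; rewrite in_itv /= => /andP[t0 _].
    have t00 := lt_trans (n0 n) t0.
    apply: derivableM => //; apply: derivable_powR; rewrite in_itv /= t00 //.
  + by apply: cvg_at_right_filter; exact: cF.
  + by apply: cvg_at_left_filter; exact: cF.
- move=> t; rewrite in_itv /= => /andP[t0 _].
  have t00 := lt_trans (n0 n) t0.
  have dp := is_derive1_powR a t00.
  rewrite derive1E derive_val /= /GRing.scale /=; field; rewrite gt_eqF //.
Qed.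

Lemma cvg_powR_pinfty (p : R) : 0 < p -> t `^ (- p) @[t --> +oo] --> (0 : R).
Proof.
move=> p0; apply/cvgrPdist_le => e e0; near=> t.
rewrite sub0r normrN ger0_norm ?powR_ge0 // powRN.
rewrite -[leRHS]invrK lef_pV2 ?posrE ?invr_gt0 ?powR_gt0 //.
have -> : e^-1 = (e^-1 `^ p^-1) `^ p.
  by rewrite -powRrM mulVf ?gt_eqF // powRr1 // invr_ge0 ltW.
have te : e^-1 `^ p^-1 <= t by near: t; exact: nbhs_pinfty_ge.
by apply: (ge0_ler_powR (ltW p0)) te; rewrite nnegrE ?powR_ge0 // ltW.
Unshelve. all: by end_near.
Qed.

Lemma integral_powR_tail (a b : R) : 0 < a -> 1 < b ->
  (\int[mu]_(t in `[a, +oo[) (t `^ (- b))%:E =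
   (a `^ (1 - b) / (b - 1))%:E)%E.
Proof.
move=> a0 b1; have b0 : 0 < b - 1 by lra.
have cF t : 0 < t -> {for t, continuous (fun t => - (b - 1)^-1 * t `^ (1 - b))}.
  by move=> t0; apply: cvgM; [exact: cvg_cst | exact: continuous_powR].
rewrite (@ge0_continuous_FTC2y _ _ (fun t => - (b - 1)^-1 * t `^ (1 - b)) _ 0) //.
- rewrite sub0e -EFinN; congr (_%:E); ring.
- by move=> t _; exact: powR_ge0.
- apply: continuous_in_subspaceT => t /[!inE] /=; rewrite in_itv /= andbT => at0.
  by apply: continuous_powR; exact: lt_le_trans at0.
- rewrite -[X in _ --> X](mulr0 (- (b - 1)^-1)); apply: cvgM; first exact: cvg_cst.
  have -> : (fun t : R => t `^ (1 - b)) = (fun t => t `^ (- (b - 1))).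
    by apply/funext => t; rewrite opprB.
  exact: cvg_powR_pinfty.
- move=> t at0; apply: derivableM => //.
  by apply: derivable_powR; rewrite in_itv /= (lt_trans a0).
- by apply: cvg_at_right_filter; exact: cF.
- move=> t; rewrite in_itv /= andbT => at0.
  have t00 := lt_trans a0 at0.
  have dp := is_derive1_powR (1 - b) t00.
  rewrite derive1E derive_val /= /GRing.scale /=.
  have -> : 1 - b - 1 = - b by ring.
  by field; rewrite gt_eqF.
Qed.

Lemma ge0_integral_split (a c : R) (f : R -> \bar R) : a <= c ->
  measurable_fun `]a, +oo[ f -> (forall t, a < t -> (0 <= f t)%E) ->
  (\int[mu]_(t in `]a, +oo[) f t =
   \int[mu]_(t in `]a, c]) f t + \int[mu]_(t in `]c, +oo[) f t)%E.
Proof.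
move=> ac mf f0.
have scaled_pgf_limit : `]a, +oo[%classic = `]a, c] `|` `]c, +oo[ :> set R.
  apply/seteqP; split => t /=; rewrite !in_itv /= ?andbT.
    by move=> ->; case: (leP t c) => tc; [left | right].
  by case=> [/andP[]//|]; exact: le_lt_trans.
rewrite scaled_pgf_limit ge0_integral_setU -?scaled_pgf_limit //.
  by move=> t /=; rewrite in_itv /= andbT; exact: f0.
apply/disj_setPS => t /=; rewrite !in_itv /= andbT => -[/andP[_ tc]].
by rewrite ltNge tc.
Qed.

Lemma integrable_halfline (G : R -> R) (a b C : R) : 0 < a -> 1 < b ->
  measurable_fun halfline G -> (forall t, 0 < t -> 0 <= G t) ->
  (forall t, 0 < t -> t <= 1 -> G t <= C * t `^ (a - 1)) ->
  (forall t, 1 <= t -> G t <= C * t `^ (- b)) ->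
  mu.-integrable halfline (EFin \o G).
Proof.
move=> a0 b1 mG G0 G01 G1y.
have C0 : 0 <= C.
  have := G0 _ (@ltr01 R); have := G1y _ (lexx 1); rewrite powR1; lra.
have mEG : measurable_fun halfline (EFin \o G) by exact/measurable_EFinP.
have pos (t : R) (D : set R) : D `<=` halfline -> D t -> 0 < t.
  by move=> DH /DH /=; rewrite in_itv /= andbT.
apply/integrableP; split => //.
have -> : (\int[mu]_(t in halfline) `|(EFin \o G) t| =
    \int[mu]_(t in halfline) (EFin \o G) t)%E.
  apply: eq_integral => t /[!inE] /=; rewrite in_itv /= andbT => t0.
  by rewrite ger0_norm // G0.
have EG0 t : 0 < t -> (0 <= (EFin \o G) t)%E by move=> t0; rewrite lee_fin G0.
rewrite (ge0_integral_split ler01 mEG EG0).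
have le_C (D : set R) (p : R) : measurable D -> D `<=` halfline ->
    (forall t, D t -> G t <= C * t `^ p) ->
    (\int[mu]_(t in D) (EFin \o G) t <=
      C%:E * \int[mu]_(t in D) (t `^ p)%:E)%E.
  move=> mD DH DG; rewrite -ge0_integralZl_EFin //; last 2 first.
    - by move=> t _; rewrite lee_fin powR_ge0.
    - by apply/measurable_EFinP; exact: measurable_powRl.
  apply: ge0_le_integral => //.
  - by move=> t Dt; rewrite lee_fin G0 // (pos t D).
  - exact: measurable_funS mEG.
  - apply/measurable_EFinP; apply: measurable_funM => //; exact: measurable_powRl.
apply: lte_add_pinfty.
  apply: le_lt_trans (le_C _ (a - 1) (measurable_itv _) _ _) _.
  - by move=> t /=; rewrite !in_itv /= => /andP[->].
  - by move=> t /=; rewrite in_itv /= => /andP[]; exact: G01.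
  - apply: le_lt_trans (lee_wpmul2l _ (integral_powR_01 a0)) _; first by rewrite lee_fin.
    by rewrite -EFinM ltry.
apply: le_lt_trans (le_C _ (- b) (measurable_itv _) _ _) _.
- by move=> t /=; rewrite !in_itv /= !andbT; exact: lt_trans.
- by move=> t /=; rewrite in_itv /= andbT => /ltW; exact: G1y.
- rewrite integral_itv_obnd_cbnd; last first.
    by apply/measurable_EFinP; exact: measurable_powRl.
  by rewrite integral_powR_tail // -EFinM ltry.
Qed.

(** Maximizing $t^p e^{-ct}$ over $t > 0$, with a slightly generous constant. *)
Lemma powR_le_expR (p c t : R) : 0 < p -> 0 < c -> 0 < t ->
  t `^ p <= (p / c) `^ p * expR (c * t).
Proof.
move=> p0 c0 t0; have pc0 : 0 < p / c by rewrite divr_gt0.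
rewrite /powR !gt_eqF // -expRD ler_expR.
have tpc : t = (p / c) * (c * t / p) by field; rewrite !gt_eqF.
have ctp : 0 < c * t / p by rewrite divr_gt0 // mulr_gt0.
rewrite {1}tpc lnM ?posrE // mulrDr lerD2l.
have /andP[_ /(ler_wpM2l (ltW p0))] := ln_bounds ctp.
rewrite mulrBr mulrCA divff ?gt_eqF // !mulr1; lra.
Qed.

Definition gamma_density (r c t : R) : R := t `^ (r - 1) * expR (- (c * t)).

Lemma measurable_gamma_density (r c : R) (D : set R) :
  measurable_fun D (gamma_density r c).
Proof.
apply: measurable_funTS; apply: measurable_funM; first exact: measurable_powR.
apply: measurableT_comp; first exact: measurable_expR.
by apply: measurableT_comp => //; exact: mulrl_measurable.
Qed.

Lemma gamma_density_ge0 (r c t : R) : 0 <= gamma_density r c t.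
Proof. by rewrite mulr_ge0 ?powR_ge0 ?expR_ge0. Qed.

Lemma integrable_gamma_density (r c : R) : 0 < r -> 0 < c ->
  mu.-integrable halfline (EFin \o gamma_density r c).
Proof.
move=> r0 c0; set C := ((r + 1) / c) `^ (r + 1).
have C0 : 0 <= C by exact: powR_ge0.
apply: (@integrable_halfline _ r 2 (1 + C)) => //; first by lra.
- exact: measurable_gamma_density.
- by move=> t _; exact: gamma_density_ge0.
- move=> t t0 _; rewrite /gamma_density mulrC ler_wpM2r ?powR_ge0 //.
  apply: (@le_trans _ _ 1); last by lra.
  by rewrite expR_le1 oppr_le0 mulr_ge0 // ltW.
- move=> t t1; have t0 : 0 < t by exact: lt_le_trans t1.
  have -> : gamma_density r c t = t `^ (r + 1) * expR (- (c * t)) * t `^ (- 2).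
    rewrite /gamma_density mulrAC -powRD; last by rewrite (gt_eqF t0) implybT.
    by congr (_ `^ _ * _); ring.
  rewrite ler_wpM2r ?powR_ge0 // expRN ler_pdivrMr ?expR_gt0 //.
  have := powR_le_expR (addr_gt0 r0 ltr01) c0 t0; rewrite -/C => H.
  apply: (le_trans H); rewrite ler_wpM2r ?expR_ge0 //; lra.
Qed.

Lemma EFin_Gamma (r : R) : 0 < r ->
  ((Gamma r)%:E = \int[mu]_(t in halfline) (gamma_density r 1 t)%:E)%E.
Proof.
move=> r0; rewrite /Gamma /Rintegral.
have -> : (\int[mu]_(t in halfline) (t `^ (r - 1) * expR (- t))%:E =
    \int[mu]_(t in halfline) (gamma_density r 1 t)%:E)%E.
  by apply: eq_integral => t _; rewrite /gamma_density mul1r.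
rewrite fineK //; apply: integrable_fin_num => //.
exact: (integrable_gamma_density r0 ltr01).
Qed.

(** Between 1 and 2 the integrand is at least [expR (- 2) / 2]. *)
Lemma Gamma_gt0 (r : R) : 0 < r -> 0 < Gamma r.
Proof.
move=> r0; rewrite -lte_fin EFin_Gamma //.
have mg (D : set R) : measurable_fun D (EFin \o gamma_density r 1).
  by apply/measurable_EFinP; exact: measurable_gamma_density.
have sub : `[1, 2]%classic `<=` halfline.
  by move=> t /=; rewrite !in_itv /= andbT => /andP[t1 _]; exact: lt_le_trans t1.
apply: (@lt_le_trans _ _ (\int[mu]_(t in `[1%R, 2%R]) (gamma_density r 1 t)%:E)%E); last first.
  apply: ge0_subset_integral; [exact: measurable_itv | exact: measurable_itv | | |].
  - exact: mg.
  - by move=> t _; rewrite lee_fin gamma_density_ge0.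
  - exact: sub.
apply: (@lt_le_trans _ _ (\int[mu]_(t in `[1%R, 2%R]) (2^-1 * expR (- (2 : R)))%:E)%E).
  rewrite integral_cst //= lebesgue_measure_itv /= lte_fin ltr1n /=.
  by rewrite -EFinB -EFinM lte_fin mulr_gt0 //; lra.
apply: ge0_le_integral; first exact: measurable_itv.
- by move=> t _; rewrite lee_fin ltW.
- exact: measurable_cst.
- exact: mg.
- move=> t /=; rewrite in_itv /= => /andP[t1 t2].
  have t0 : 0 < t by exact: lt_le_trans t1.
  rewrite lee_fin /gamma_density mul1r; apply: ler_pM; rewrite ?expR_ge0 ?invr_ge0 //.
    rewrite powRB ?(gt_eqF t0) ?implybT // powRr1 ?(ltW t0) //.
    apply: (@le_trans _ _ (t^-1)); first by rewrite lef_pV2 ?posrE.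
    rewrite -[leLHS]mul1r ler_wpM2r ?invr_ge0 ?(ltW t0) //.
    by rewrite -(powRr0 t); apply: ler_powR => //; exact: ltW.
  by rewrite ler_expR lerN2.
Qed.

(** The linear substitution is applied on closed half-lines that avoid the possible
    singularity of [t `^ (r - 1)] at 0 and exhaust the positive reals. *)
Lemma integral_gamma_density (r y : R) : 0 < r -> 0 < y ->
  (\int[mu]_(t in halfline) (gamma_density r y t)%:E =
   (y `^ (- r) * Gamma r)%:E)%E.
Proof.
move=> r0 y0.
pose F (k : R) (n : nat) : set R := `[k * n.+2%:R^-1, +oo[%classic.
have lim (k c : R) : 0 < k ->
    (\int[mu]_(t in F k n) (gamma_density r c t)%:E)%E @[n --> \oo] -->
    (\int[mu]_(t in halfline) (gamma_density r c t)%:E)%E.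
  move=> k0; have n0 n : 0 < k * n.+2%:R^-1 by rewrite mulr_gt0 // invr_gt0 ltr0n.
  apply: cvg_integral_exhaustion.
  - exact: measurable_itv.
  - by move=> n; exact: measurable_itv.
  - move=> n t; rewrite /F /= !in_itv /= !andbT; exact: lt_le_trans.
  - move=> n m nm t; rewrite /F /= !in_itv /= !andbT; apply: le_trans.
    by rewrite ler_wpM2l ?(ltW k0) // lef_pV2 ?posrE ?ltr0n // ler_nat.
  - move=> t /=; rewrite in_itv /= andbT => t0.
    have [n Hn] := exists_invr_le (divr_gt0 t0 k0); exists n.
    by rewrite /F /= in_itv /= andbT mulrC -ler_pdivlMr.
  - by apply/measurable_EFinP; exact: measurable_gamma_density.
  - by move=> t _; rewrite lee_fin gamma_density_ge0.
have subst n : (\int[mu]_(t in F y n) (gamma_density r 1 t)%:E =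
    (y `^ r)%:E * \int[mu]_(t in F 1%R n) (gamma_density r y t)%:E)%E.
  have n0 : (0 : R) < 1 * n.+2%:R^-1 by rewrite mul1r invr_gt0 ltr0n.
  have dF : (fun t : R => y * t)^`()%classic = cst y.
    apply/funext => t; rewrite derive1E derive_val /=.
    by rewrite /GRing.scale /= ?mulr1 ?mulr0 ?addr0.
  rewrite /F; have -> : y * n.+2%:R^-1 = y * (1 * n.+2%:R^-1) by rewrite mul1r.
  rewrite (@increasing_ge0_integration_by_substitutiony _ (fun t => y * t)) //.
  - rewrite -ge0_integralZl_EFin ?powR_ge0 //.
    + apply: eq_integral => t /[!inE] /=; rewrite in_itv /= andbT => tn.
      have t0 : 0 < t by exact: lt_le_trans tn.
      rewrite -EFinM /=; congr (_%:E).
      rewrite dF !fctE /= /gamma_density powRM ?(ltW y0) ?(ltW t0) // mul1r.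
      have -> : y `^ r = y `^ (r - 1) * y.
        by rewrite -[X in _ * X]powRr1 ?(ltW y0) // -powRD ?subrK // (gt_eqF y0) implybT.
      ring.
    + by move=> t _; rewrite lee_fin gamma_density_ge0.
    + by apply/measurable_EFinP; exact: measurable_gamma_density.
  - by move=> u v _ _ uv; rewrite ltr_pM2l.
  - by rewrite dF => t _; exact: cvg_cst.
  - by rewrite dF; exact: is_cvg_cst.
  - by rewrite dF; exact: is_cvg_cst.
  - split; last by apply: cvg_at_right_filter; exact: mulrl_continuous.
    by move=> t _; apply: derivableM.
  - exact: (gt0_cvgMry y0 cvg_id).
  - apply: continuous_in_subspaceT => t /[!inE] /=; rewrite in_itv /= andbT => tn.
    have t0 : 0 < t by apply: lt_le_trans tn; rewrite mulr_gt0.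
    apply: cvgM; first exact: continuous_powR.
    apply: continuous_comp; last exact: continuous_expR.
    apply: continuous_comp; last exact: oppr_continuous.
    exact: mulrl_continuous.
  - by move=> t _; exact: gamma_density_ge0.
have lim1 := lim y 1 y0.
have lim2 : (\int[mu]_(t in F y n) (gamma_density r 1 t)%:E)%E @[n --> \oo] -->
    ((y `^ r)%:E * \int[mu]_(t in halfline) (gamma_density r y t)%:E)%E.
  rewrite (_ : (fun n => _) = (fun n =>
      (y `^ r)%:E * \int[mu]_(t in F 1%R n) (gamma_density r y t)%:E)%E).
    by apply: cvgeZl => //; exact: lim.
  by apply/funext => n; exact: subst.
have E : (\int[mu]_(t in halfline) (gamma_density r 1 t)%:E =
   (y `^ r)%:E * \int[mu]_(t in halfline) (gamma_density r y t)%:E)%E.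
  exact: (cvg_unique _ lim1 lim2).
rewrite EFinM EFin_Gamma // E muleA -EFinM powRN mulVf ?mul1e //.
by rewrite gt_eqF // powR_gt0.
Qed.


End HalfLineIntegrals.

(** * The generations of the process *)
Section NatValued.
Context d (T : measurableType d) (R : realType) (P : probability T R).

Lemma measurable_nat_fibers (V : T -> nat) :
  (forall k, measurable (V @^-1` [set k])) -> measurable_fun [set: T] V.
Proof.
move=> mV _ B _; rewrite setTI.
have -> : V @^-1` B = \bigcup_(k in B) (V @^-1` [set k]).
  apply/seteqP; split => [w Bw|w [k Bk] /= ->//]; by exists (V w).
by apply: bigcup_measurable => k _; exact: mV.
Qed.

Lemma ge0_integral_fibers (A : set T) (V : T -> nat) (f : T -> \bar R) :
  measurable A -> measurable_fun [set: T] V -> measurable_fun A f ->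
  (forall w, A w -> (0 <= f w)%E) ->
  (\int[P]_(w in A) f w =
   \sum_(k <oo) \int[P]_(w in A `&` V @^-1` [set k]) f w)%E.
Proof.
move=> mA mV mf f0.
have mF k : measurable (A `&` V @^-1` [set k]).
  by apply: measurableI => //; rewrite -[X in measurable X]setTI; exact: mV.
have E : A = \bigcup_k (A `&` V @^-1` [set k]).
  apply/seteqP; split => [w Aw|w [k _ []]//]; by exists (V w).
rewrite {1}E ge0_integral_bigcup -?E //.
move=> k l _ _ [w /= [[_ Vk] [_ Vl]]]; by rewrite -Vk -Vl.
Qed.

Lemma integral_comp_nat (A : set T) (V : T -> nat) (phi : nat -> R) :
  measurable A -> measurable_fun [set: T] V -> (forall k, 0 <= phi k) ->
  (\int[P]_(w in A) (phi (V w))%:E =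
   \sum_(k <oo) (phi k)%:E * P (A `&` V @^-1` [set k]))%E.
Proof.
move=> mA mV phi0.
rewrite (ge0_integral_fibers mA mV); last 2 first.
- apply/measurable_EFinP; apply: measurable_funTS.
  by apply: measurableT_comp mV.
- by move=> w _; rewrite lee_fin.
apply: eq_eseriesr => k _.
have mAk : measurable (A `&` V @^-1` [set k]).
  by apply: measurableI => //; rewrite -[X in measurable X]setTI; exact: mV.
rewrite -integral_cst //; apply: eq_integral => w.
by rewrite inE => -[_ /= ->].
Qed.

Lemma integral_one : (\int[P]_w (1 : R)%:E = 1)%E.
Proof. by rewrite integral_cst // mul1e; exact: probability_setT. Qed.

End NatValued.

Section Independence.
Context d (T : measurableType d) (R : realType) (P : probability T R).
Context {I : eqType} (X : I -> {RV P >-> nat}).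

(** The product rule for [E] together with finitely many of the variables [X i].
    With [E] an event of the past and [K] the indices of the future, this is the
    only consequence of independence that the branching recursion uses. *)
Definition indep_of (E : set T) (K : pred I) : Prop :=
  measurable E /\ forall (J : seq I) (B : I -> set nat),
    uniq J -> {subset J <= K} ->
    P (E `&` \bigcap_(i in [set` J]) (X i @^-1` B i)) =
    (P E * \prod_(i <- J) P (X i @^-1` B i))%E.

Let mX (i : I) (B : set nat) : measurable (X i @^-1` B).
Proof. by rewrite -[X in measurable X]setTI; exact: measurable_funPT. Qed.

Let mXs (J : seq I) (B : I -> set nat) :
  measurable (\bigcap_(i in [set` J]) (X i @^-1` B i)).
Proof. by apply: fin_bigcap_measurable => // i _; exact: mX. Qed.

Lemma indep_of_sub E (K K' : pred I) : {subset K' <= K} ->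
  indep_of E K -> indep_of E K'.
Proof.
move=> KK' [mE IE]; split => // J B uJ JK; apply: IE => // i /JK; exact: KK'.
Qed.

Lemma indep_of_fiber E (K : pred I) j (B : set nat) : indep_of E K -> K j ->
  indep_of (E `&` X j @^-1` B) [pred i | (i != j) && K i] /\
  (P (E `&` X j @^-1` B) = P E * P (X j @^-1` B))%E.
Proof.
move=> [mE IE] Kj.
have PE : (P (E `&` X j @^-1` B) = P E * P (X j @^-1` B))%E.
  have jK : {subset [:: j] <= K} by move=> i; rewrite inE => /eqP ->.
  have := IE [:: j] (fun=> B) isT jK; rewrite big_seq1 => <-.
  congr (P (_ `&` _)); apply/seteqP; split => w.
    by move=> Bw i; rewrite /mkset inE => /eqP ->.
  by apply; rewrite /mkset inE.
split => //; split; first exact: measurableI.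
move=> J B' uJ JK.
have jJ : j \notin J by apply/negP => /JK; rewrite inE eqxx.
pose B'' i := if i == j then B else B' i.
have B''j : B'' j = B by rewrite /B'' eqxx.
have eqB i : i \in J -> B'' i = B' i.
  by rewrite /B''; case: eqP => // -> /(negP jJ).
have jJK : {subset j :: J <= K}.
  by move=> i; rewrite inE => /predU1P[-> //|/JK]; rewrite inE => /andP[].
have ujJ : uniq (j :: J) by rewrite /= jJ uJ.
have := IE (j :: J) B'' ujJ jJK.
rewrite big_cons B''j PE muleA.
have -> : (\prod_(i <- J) P (X i @^-1` B'' i) = \prod_(i <- J) P (X i @^-1` B' i))%E.
  by apply: eq_big_seq => i /eqB ->.
move=> <-; congr (P _); apply/seteqP; split => w.
  move=> [[Ew Bw] Jw]; split => // i /=; rewrite inE => /predU1P[->|iJ].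
    by rewrite B''j.
  by rewrite eqB //; exact: Jw.
move=> [Ew Jw]; split; first split => //.
  by have := Jw j; rewrite /mkset inE eqxx B''j => /(_ isT).
by move=> i iJ; have := Jw i; rewrite /mkset inE iJ orbT eqB // => /(_ isT).
Qed.

Lemma indep_of_bigcup (E : nat -> set T) (K : pred I) :
  trivIset setT E -> (forall k, indep_of (E k) K) ->
  indep_of (\bigcup_k E k) K.
Proof.
move=> tE IE; have mE k : measurable (E k) by have [] := IE k.
split; first exact: bigcupT_measurable.
move=> J B uJ JK; rewrite setI_bigcupl.
rewrite measure_bigcup //; last 2 first.
- by move=> k _; apply: measurableI.
- exact: trivIset_setIr.
rewrite measure_bigcup //.
have prod_fin : (\prod_(i <- J) P (X i @^-1` B i))%E \is a fin_num.
  by elim/big_rec: _ => // i x _ xfin; rewrite fin_numM // fin_num_measure.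
rewrite -(fineK prod_fin) muleC -nneseriesZl; last by [].
by apply: eq_eseriesr => k _; rewrite fineK // [RHS]muleC; exact: (proj2 (IE k) J B uJ JK).
Qed.

(** Adding an independent summand consumes its index. *)
Lemma indep_of_add (E : set T) (V : T -> nat) (K : pred I) j :
  (forall k, indep_of (E `&` V @^-1` [set k]) K) -> K j ->
  forall k, indep_of (E `&` (fun w => (V w + X j w)%N) @^-1` [set k]) [pred i | (i != j) && K i].
Proof.
move=> IV Kj k.
have -> : E `&` (fun w => (V w + X j w)%N) @^-1` [set k] =
    \bigcup_a (E `&` V @^-1` [set a] `&` X j @^-1` [set b | (a + b)%N = k]).
  apply/seteqP; split => w /=.
    by move=> [Ew Vk]; exists (V w).
  by move=> [a _ /= [[Ew <-] ab]].
apply: indep_of_bigcup.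
  move=> a b _ _ [w /= [[[_ Va] _] [[_ Vb] _]]]; by rewrite -Va -Vb.
by move=> a; have [] := indep_of_fiber [set b | (a + b)%N = k] (IV a) Kj.
Qed.

(** Splitting over the values of [X j] and then of [V] reduces this to the product
    rule for events. *)
Lemma integral_expr_add (E : set T) (V : T -> nat) (K : pred I) j
    (p : nat -> R) (x : R) : measurable E -> measurable_fun [set: T] V ->
  (forall k, indep_of (E `&` V @^-1` [set k]) K) -> K j ->
  has_pmf (X j) p -> cvgn (series p) -> 0 <= x <= 1 ->
  (\int[P]_(w in E) (x ^+ (V w + X j w))%:E =
   (pgf p x)%:E * \int[P]_(w in E) (x ^+ V w)%:E)%E.
Proof.
move=> mE mV IV Kj Xp cp x01; have /andP[x0 x1] := x01.
have p0 k : 0 <= p k by rewrite -lee_fin -Xp.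
have xk0 k : 0 <= x ^+ k by exact: exprn_ge0.
have mXj : measurable_fun [set: T] (X j) by exact: measurable_funPT.
have mexpr (A : set T) (W : T -> nat) : measurable_fun [set: T] W ->
    measurable_fun A (fun w => (x ^+ W w)%:E).
  move=> mW; apply/measurable_EFinP; apply: measurable_funTS.
  exact: (@measurableT_comp _ _ _ _ _ _ (fun k => x ^+ k)) mW.
rewrite (ge0_integral_fibers P mE mXj); last 2 first.
- apply: mexpr; exact: measurable_fun_addn.
- by move=> w _; rewrite lee_fin.
have cpx := is_cvg_pgf p0 cp x01.
rewrite EFin_sum //; last by move=> k; rewrite mulr_ge0.
have I0 : (0 <= \int[P]_(w in E) (x ^+ V w)%:E)%E.
  by apply: integral_ge0 => w _; rewrite lee_fin.
have Ifin : (\int[P]_(w in E) (x ^+ V w)%:E)%E \is a fin_num.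
  rewrite ge0_fin_numE //; apply: (@le_lt_trans _ _ (\int[P]_(w in E) 1%:E)%E).
    apply: ge0_le_integral => //; [by move=> w _; rewrite lee_fin|exact: mexpr|].
    by move=> w _; rewrite lee_fin exprn_ile1.
  by rewrite integral_cst // mul1e (le_lt_trans (probability_le1 _ mE)) // ltry.
rewrite muleC -(fineK Ifin) -nneseriesZl; last first.
  by move=> k _; rewrite lee_fin mulr_ge0.
apply: eq_eseriesr => a _.
have mEa : measurable (E `&` X j @^-1` [set a]).
  by apply: measurableI => //; exact: mX.
transitivity (\int[P]_(w in E `&` X j @^-1` [set a]) ((x ^+ a)%:E * (x ^+ V w)%:E))%E.
  apply: eq_integral => w; rewrite inE => -[_ /= ->].
  by rewrite -EFinM -exprD addnC.
rewrite ge0_integralZl_EFin //; last 2 first.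
- by move=> w _; rewrite lee_fin.
- exact: mexpr.
rewrite fineK // [(p a * _)%R]mulrC EFinM [RHS]muleC -muleA; congr (_ * _)%E.
rewrite (integral_comp_nat P mEa mV xk0) (integral_comp_nat P mE mV xk0).
rewrite -nneseriesZl; last by move=> k _; rewrite mule_ge0 ?lee_fin ?measure_ge0.
apply: eq_eseriesr => k _.
have [_ Ek] := indep_of_fiber [set a] (IV k) Kj.
by rewrite setIAC Ek Xp [RHS]muleCA; congr (_ * _)%E; rewrite muleC.
Qed.

End Independence.

Section GaltonWatson.
Context d (T : measurableType d) (R : realType) (P : probability T R).
Context (p h : nat -> R).
Context (xi : nat -> nat -> {RV P >-> nat}) (Y : nat -> {RV P >-> nat}).
Hypothesis inputs : gwi_inputs p h xi Y.

Lemma pmf_ge0_sum1 (X : {RV P >-> nat}) (q : nat -> R) : has_pmf X q ->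
  [/\ forall k, 0 <= q k, cvgn (series q) & limn (series q) = 1].
Proof.
move=> Xq; have q0 k : 0 <= q k by rewrite -lee_fin -Xq.
have mX : measurable_fun [set: T] X by exact: measurable_funPT.
have sum1 : (\sum_(k <oo) (q k)%:E = 1)%E.
  have := integral_comp_nat P measurableT mX (fun=> ler01 : 0 <= (1 : R)).
  rewrite integral_one => ->.
  by apply: eq_eseriesr => k _; rewrite mul1e setTI Xq.
have cq : cvgn (series q) by apply: is_cvg_sum_lty => //; rewrite sum1 ltry.
by split => //; apply/eqP; rewrite -eqe EFin_sum // sum1.
Qed.

Lemma pmf_mean (X : {RV P >-> nat}) (q : nat -> R) : has_pmf X q ->
  ('E_P[fun w => (X w)%:R] = \sum_(k <oo) (q k * k%:R)%:E)%E.
Proof.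
move=> Xq; have mX : measurable_fun [set: T] X by exact: measurable_funPT.
rewrite unlock (integral_comp_nat P measurableT mX (fun k => ler0n R k)).
by apply: eq_eseriesr => k _; rewrite setTI Xq -EFinM mulrC.
Qed.

Let X := gwi_family xi Y.

Definition later (n : nat) : pred ((nat * nat) + nat) :=
  fun j => match j with inl (m, _) => (n <= m)%N | inr m => (n <= m)%N end.

(** The inputs, of generation [n] and later, that are still unused once the first
    [i] offspring variables of generation [n] have been added up. *)
Definition later_from (n i : nat) : pred ((nat * nat) + nat) :=
  fun j => match j with
    inl (m, l) => (n < m)%N || (m == n) && (i <= l)%N | inr m => (n <= m)%N end.

Let Z := gwi xi Y.

Definition offspring_sum (n i : nat) (w : T) : nat := (\sum_(l < i) xi n l w)%N.

Lemma offspring_sumS n i :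
  offspring_sum n i.+1 = (fun w => offspring_sum n i w + xi n i w)%N.
Proof. by apply/funext => w; rewrite /offspring_sum big_ord_recr. Qed.

Lemma measurable_offspring_sum n i :
  measurable_fun [set: T] (offspring_sum n i).
Proof.
elim: i => [|i IH].
  have -> : offspring_sum n 0 = fun=> 0%N.
    by apply/funext => w; rewrite /offspring_sum big_ord0.
  exact: measurable_cst.
by rewrite offspring_sumS; apply: measurable_fun_addn => //; exact: measurable_funPT.
Qed.

Lemma indep_offspring_sum (E : set T) n : indep_of X E (later n) ->
  forall i k, indep_of X (E `&` offspring_sum n i @^-1` [set k]) (later_from n i).
Proof.
move=> IE; elim=> [|i IH] k.
  have IE' : indep_of X E (later_from n 0).
    apply: indep_of_sub IE => -[[m l]|m]; rewrite !unfold_in //= andbT.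
    by move=> /orP[/ltnW//|/eqP ->].
  have [->|k0] := eqVneq k 0%N.
    have -> : E `&` offspring_sum n 0 @^-1` [set 0%N] = E.
      by apply/seteqP; split => w /=; rewrite /offspring_sum big_ord0 //; case.
    by [].
  have -> : E `&` offspring_sum n 0 @^-1` [set k] = set0.
    apply/seteqP; split => w //=; rewrite /offspring_sum big_ord0.
    by move=> [_ /eqP]; rewrite eq_sym (negbTE k0).
  by split => // J B uJ JK; rewrite set0I measure0 mul0e.
rewrite offspring_sumS.
have Ki : later_from n i (inl (n, i)) by rewrite /= eqxx leqnn orbT.
apply: indep_of_sub (indep_of_add IH Ki k) => -[[m l]|m]; rewrite !unfold_in //=.
case: (ltnP n m) => [nm _|_ /= /andP[/eqP -> il]]; apply/andP; split => //.
- by apply/negP => /eqP[mn _]; rewrite mn ltnn in nm.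
- by apply/negP => /eqP[li]; rewrite li ltnn in il.
- by rewrite eqxx (ltnW il).
Qed.

Lemma gwi_fiber_split n k : Z n.+1 @^-1` [set k] =
  \bigcup_z (Z n @^-1` [set z] `&`
    (fun w => (offspring_sum n z w + Y n w)%N) @^-1` [set k]).
Proof.
apply/seteqP; split => w /=; first by move=> Zk; exists (Z n w).
by move=> [z _ [/= <-]].
Qed.

(** The value of [Z n.+1] is determined by that of [Z n] and by inputs of
    generation [n]; splitting over the value [z] of [Z n] makes the number of
    offspring variables deterministic. *)
Lemma indep_gwi n k : indep_of X (Z n @^-1` [set k]) (later n).
Proof.
elim: n k => [|n IH] k.
  have [->|k0] := eqVneq k 0%N.
    have -> : Z 0 @^-1` [set 0%N] = setT by apply/seteqP; split.
    split => // J B uJ _; rewrite setTI probability_setT mul1e.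
    exact: (gwi_independent inputs).
  have -> : Z 0 @^-1` [set k] = set0.
    by apply/seteqP; split => w //= /eqP; rewrite eq_sym (negbTE k0).
  by split => // J B uJ JK; rewrite set0I measure0 mul0e.
rewrite gwi_fiber_split; apply: indep_of_bigcup.
  by move=> a b _ _ [w /= [[Za _] [Zb _]]]; rewrite -Za -Zb.
move=> z; have IS := indep_offspring_sum (IH z) z.
have KY : later_from n z (inr n) by rewrite /=.
apply: indep_of_sub (indep_of_add IS KY k) => -[[m l]|m]; rewrite !unfold_in /=.
  by move=> ->.
by move=> nm; rewrite (ltnW nm) andbT; apply/negP => /eqP[mn]; rewrite mn ltnn in nm.
Qed.

Lemma measurable_gwi n : measurable_fun [set: T] (Z n).
Proof. by apply: measurable_nat_fibers => k; have [] := indep_gwi n k. Qed.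

Definition gwi_pmf (n k : nat) : R := fine (P (Z n @^-1` [set k])).

Lemma EFin_gwi_pmf n k : (gwi_pmf n k)%:E = P (Z n @^-1` [set k]).
Proof.
rewrite fineK // fin_num_measure //; have [] := indep_gwi n k; by [].
Qed.

Lemma gwi_pmf_ge0_sum1 n :
  [/\ forall k, 0 <= gwi_pmf n k, cvgn (series (gwi_pmf n)) &
      limn (series (gwi_pmf n)) = 1].
Proof.
pose mf := isMeasurableFun.Build _ _ _ _ (Z n) (measurable_gwi n).
pose Zn : {RV P >-> nat} := HB.pack (Z n) mf.
by apply: (@pmf_ge0_sum1 Zn) => k; rewrite EFin_gwi_pmf.
Qed.

Lemma integral_gwi (n : nat) (phi : nat -> R) : (forall k, 0 <= phi k) ->
  (\int[P]_w (phi (Z n w))%:E = \sum_(k <oo) (gwi_pmf n k * phi k)%:E)%E.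
Proof.
move=> phi0; rewrite (integral_comp_nat P measurableT (measurable_gwi n) phi0).
by apply: eq_eseriesr => k _; rewrite setTI EFinM EFin_gwi_pmf muleC.
Qed.

Lemma integral_expr_gwi n x : 0 <= x <= 1 ->
  (\int[P]_w (x ^+ Z n w)%:E = (pgf (gwi_pmf n) x)%:E)%E.
Proof.
move=> x01; have /andP[x0 x1] := x01; have [q0 cq _] := gwi_pmf_ge0_sum1 n.
rewrite integral_gwi; last by move=> k; exact: exprn_ge0.
rewrite EFin_sum //; last exact: is_cvg_pgf.
by move=> k; rewrite mulr_ge0 // exprn_ge0.
Qed.

Lemma gwi_HE n x : 0 <= x <= 1 -> gwi_H P Z n x = pgf (gwi_pmf n) x.
Proof. by move=> x01; rewrite /gwi_H unlock integral_expr_gwi. Qed.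

Lemma gwi_H0 x : gwi_H P Z 0 x = 1.
Proof.
rewrite /gwi_H unlock /=; under eq_integral do rewrite expr0.
by rewrite integral_one.
Qed.

Lemma integral_expr_offspring_sum (E : set T) n i x : 0 <= x <= 1 ->
  indep_of X E (later n) ->
  (\int[P]_(w in E) (x ^+ offspring_sum n i w)%:E =
   (pgf p x ^+ i)%:E * P E)%E.
Proof.
move=> x01 IE; have [mE _] := IE.
have xi_pmf := gwi_offspring inputs n.
elim: i => [|i IH].
  under eq_integral do rewrite /offspring_sum big_ord0 expr0.
  by rewrite integral_cst.
have [_ cp _] := pmf_ge0_sum1 (xi_pmf i).
have Ki : later_from n i (inl (n, i)) by rewrite /= eqxx leqnn orbT.
rewrite offspring_sumS.
rewrite (integral_expr_add mE (measurable_offspring_sum n i)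
  (indep_offspring_sum IE i) Ki (xi_pmf i) cp x01).
by rewrite IH muleA -EFinM exprS.
Qed.

Lemma pgf_01 (X0 : {RV P >-> nat}) (q : nat -> R) x : has_pmf X0 q ->
  0 <= x <= 1 -> 0 <= pgf q x <= 1.
Proof.
move=> Xq x01; have /andP[x0 x1] := x01.
have [q0 cq q1] := pmf_ge0_sum1 Xq; apply/andP; split.
  by apply: sum_ge0; [move=> k; rewrite mulr_ge0 // exprn_ge0 | exact: is_cvg_pgf].
rewrite -q1; apply: sum_le => // k.
by rewrite mulr_ge0 ?exprn_ge0 //= ler_piMr // exprn_ile1.
Qed.

(** Given [Z n = z], the next generation is a sum of [z] offspring variables and
    one immigration variable, all independent. *)
Lemma gwi_HS n x : 0 <= x <= 1 ->
  gwi_H P Z n.+1 x = pgf h x * gwi_H P Z n (pgf p x).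
Proof.
move=> x01; have /andP[x0 x1] := x01.
have f01 := pgf_01 (gwi_offspring inputs 0 0) x01.
have /andP[f0 f1] := f01.
have [q0 cq _] := gwi_pmf_ge0_sum1 n.
rewrite [in RHS]gwi_HE // /gwi_H unlock.
have mexpr (W : T -> nat) : measurable_fun [set: T] W ->
    measurable_fun [set: T] (fun w => (x ^+ W w)%:E).
  move=> mW; apply/measurable_EFinP.
  exact: (@measurableT_comp _ _ _ _ _ _ (fun k => x ^+ k)) mW.
rewrite (ge0_integral_fibers P measurableT (measurable_gwi n)); last 2 first.
- exact: mexpr (measurable_gwi n.+1).
- by move=> w _; rewrite lee_fin exprn_ge0.
have -> : (\sum_(z <oo) \int[P]_(w in [set: T] `&` Z n @^-1` [set z]) (x ^+ Z n.+1 w)%:E =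
    \sum_(z <oo) (pgf h x)%:E * (gwi_pmf n z * pgf p x ^+ z)%:E)%E.
  apply: eq_eseriesr => z _; rewrite setTI.
  have IZ := indep_gwi n z; have [mZ _] := IZ.
  have KY : later_from n z (inr n) by rewrite /=.
  have Y_pmf := gwi_immigration inputs n.
  have [_ ch _] := pmf_ge0_sum1 Y_pmf.
  transitivity (\int[P]_(w in Z n @^-1` [set z]) (x ^+ (offspring_sum n z w + Y n w))%:E)%E.
    by apply: eq_integral => w; rewrite inE /= => <-.
  rewrite (integral_expr_add mZ (measurable_offspring_sum n z)
    (indep_offspring_sum IZ z) KY Y_pmf ch x01).
  by rewrite integral_expr_offspring_sum // EFinM EFin_gwi_pmf [(P _ * _)%E]muleC.
rewrite nneseriesZl; last by move=> z _; rewrite lee_fin mulr_ge0 // exprn_ge0.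
rewrite -EFin_sum; last 2 first.
- by move=> z; rewrite mulr_ge0 // exprn_ge0.
- exact: is_cvg_pgf.
by rewrite -EFinM.
Qed.

Lemma gwi_H_hprod n x : 0 <= x <= 1 ->
  gwi_H P Z n x = hprod (pgf p) (pgf h) n x.
Proof.
elim: n x => [|n IH] x x01; first by rewrite gwi_H0 /hprod big_ord0.
rewrite gwi_HS // IH; last exact: pgf_01 (gwi_offspring inputs 0 0) x01.
rewrite /hprod big_ord_recl /=; congr (_ * _).
by apply: eq_bigr => k _; rewrite -iterSr.
Qed.

End GaltonWatson.

(** * Negative moments as Laplace integrals *)
Section NegativeMoments.
Context {R : realType}.
Local Notation mu := (@lebesgue_measure R).
Local Notation halfline := (`]0, +oo[%classic : set R).

(** Rescaling by [K < 1] makes the differentiated series summable up to the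
    boundary, which reduces the claim to the termwise derivative. *)
Lemma continuous_pgf (a : nat -> R) (x : R) : (forall k, 0 <= a k) ->
  cvgn (series a) -> 0 < x < 1 -> {for x, continuous (pgf a)}.
Proof.
move=> a0 ca /andP[x0 x1]; set K := (1 + x) / 2.
have K0 : 0 < K by rewrite /K; lra.
have K01 : 0 <= K < 1 by rewrite /K; apply/andP; split; lra.
have K01' : 0 <= K <= 1 by have /andP[-> /ltW] := K01.
pose b k := a k * K ^+ k.
have b0 k : 0 <= b k by rewrite mulr_ge0 // exprn_ge0 // ltW.
have cb : cvgn (series b) by exact: is_cvg_pgf.
have cdb : cvgn (series (pseries_diffs b)).
  have -> : pseries_diffs b = (fun k => K * (pseries_diffs a k * K ^+ k)).
    by apply/funext => k; rewrite /pseries_diffs /b exprS; ring.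
  exact: is_cvg_sumZ (is_cvg_pseries_diffs_inside a0 ca K01).
have E : pgf a = pgf b \o (fun y => y / K).
  apply/funext => y; rewrite /= /pgf; congr (limn (series _)); apply/funext => k.
  by rewrite /b -mulrA -exprMn mulrCA divff ?mulr1 // gt_eqF.
have xK : 0 < x / K < 1.
  by rewrite divr_gt0 //= ltr_pdivrMr // mul1r /K; lra.
have dxK := is_derive_pgf b0 cb cdb xK.
rewrite E; apply: continuous_comp; first exact: mulrr_continuous.
have /derivable1_diffP/differentiable_continuous : derivable (pgf b) (x / K) 1.
  exact: ex_derive.
exact.
Qed.

Definition laplace_density (q : nat -> R) (r c s : R) : R :=
  pgf q (expR (- (s / c))) * s `^ (r - 1).

Lemma expRN_01 (s : R) : 0 < s -> 0 < expR (- s) < 1.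
Proof. by move=> s0; rewrite expR_gt0 expR_lt1 oppr_lt0. Qed.

Lemma continuous_laplace_density (q : nat -> R) (r c s : R) :
  (forall k, 0 <= q k) -> cvgn (series q) -> 0 < c -> 0 < s ->
  {for s, continuous (laplace_density q r c)}.
Proof.
move=> q0 cq c0 s0; apply: cvgM; last exact: continuous_powR.
have sc0 : 0 < s / c by rewrite divr_gt0.
suff : {for s, continuous (pgf q \o (fun s => expR (- (s / c))))} by [].
apply: continuous_comp; last exact: continuous_pgf (expRN_01 sc0).
apply: continuous_comp; last exact: continuous_expR.
apply: continuous_comp; last exact: oppr_continuous.
exact: mulrr_continuous.
Qed.

Lemma measurable_laplace_density (q : nat -> R) (r c : R) :
  (forall k, 0 <= q k) -> cvgn (series q) -> 0 < c ->
  measurable_fun halfline (laplace_density q r c).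
Proof.
move=> q0 cq c0; apply: open_continuous_measurable_fun; first exact: interval_open.
move=> s; rewrite inE /= in_itv /= andbT => s0.
exact: continuous_laplace_density.
Qed.

Lemma laplace_density_ge0 (q : nat -> R) (r c s : R) :
  (forall k, 0 <= q k) -> cvgn (series q) -> 0 < c -> 0 < s ->
  0 <= laplace_density q r c s.
Proof.
move=> q0 cq c0 s0; rewrite mulr_ge0 ?powR_ge0 //.
have /andP[e0 e1] := expRN_01 (divr_gt0 s0 c0).
apply: sum_ge0 => [k|]; first by rewrite mulr_ge0 // exprn_ge0 // ltW.
by apply: is_cvg_pgf => //; rewrite !ltW.
Qed.

Lemma is_cvg_negative_moment (q : nat -> R) (r : R) : (forall k, 0 <= q k) ->
  q 0%N = 0 -> cvgn (series q) -> 0 < r ->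
  cvgn (series (fun k => q k * k%:R `^ (- r))).
Proof.
move=> q0 q00 cq r0; apply: is_cvg_series_le cq => k.
rewrite mulr_ge0 ?powR_ge0 //=; case: k => [|k]; first by rewrite q00 mul0r.
rewrite ler_piMr // powRN invf_le1 ?powR_gt0 ?ltr0n //.
by rewrite -[leLHS](powRr0 k.+1%:R); apply: ler_powR; [rewrite ler1n | exact: ltW].
Qed.

(** The identity [Gamma r * y `^ (- r) = \int_0^oo exp (- y s) s `^ (r - 1) ds],
    averaged over [y = k / c] with weights [q k]. *)
Lemma negative_moment_integral (q : nat -> R) (r c : R) : (forall k, 0 <= q k) ->
  q 0%N = 0 -> cvgn (series q) -> 0 < r -> 0 < c ->
  ((Gamma r * (c `^ r * limn (series (fun k => q k * k%:R `^ (- r)))))%:E =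
   \int[mu]_(s in halfline) (laplace_density q r c s)%:E)%E.
Proof.
move=> q0 q00 cq r0 c0.
have cm := is_cvg_negative_moment q0 q00 cq r0.
have G0 : 0 <= Gamma r by rewrite ltW // Gamma_gt0.
pose term k s := ((q k)%:E * (gamma_density r (k%:R / c) s)%:E)%E.
have -> : (\int[mu]_(s in halfline) (laplace_density q r c s)%:E =
    \int[mu]_(s in halfline) \sum_(k <oo) term k s)%E.
  apply: eq_integral => s /[!inE] /=; rewrite in_itv /= andbT => s0.
  have /andP[e0 e1] := expRN_01 (divr_gt0 s0 c0).
  have e01 : 0 <= expR (- (s / c)) <= 1 by rewrite !ltW.
  have cs := is_cvg_sumZ (s `^ (r - 1)) (is_cvg_pgf q0 cq e01).
  rewrite /laplace_density mulrC -sumZ; last exact: is_cvg_pgf.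
  rewrite EFin_sum //; last first.
    by move=> k; rewrite mulr_ge0 ?powR_ge0 // mulr_ge0 // exprn_ge0 // ltW.
  apply: eq_eseriesr => k _; rewrite /term -EFinM /gamma_density; congr (_%:E).
  have -> : expR (- (s / c)) ^+ k = expR (- (k%:R / c * s)).
    by rewrite -expRM_natl; congr expR; ring.
  by ring.
rewrite integral_nneseries //; last 2 first.
- move=> k; apply: measurable_funeM; apply/measurable_EFinP.
  exact: measurable_gamma_density.
- by move=> k s _; rewrite mule_ge0 // lee_fin // gamma_density_ge0.
rewrite mulrA -sumZ // EFin_sum; last 2 first.
- by move=> k; rewrite !mulr_ge0 ?powR_ge0.
- exact: is_cvg_sumZ.
apply: eq_eseriesr => k _; rewrite /term.
rewrite ge0_integralZl_EFin //; last 2 first.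
- by move=> s _; rewrite lee_fin gamma_density_ge0.
- by apply/measurable_EFinP; exact: measurable_gamma_density.
case: k => [|k]; first by rewrite q00 mul0r mulr0 mul0e.
rewrite integral_gamma_density ?divr_gt0 // -EFinM; congr (_%:E).
have cE : c^-1 `^ (- r) = c `^ r.
  by rewrite -powR_inv1 ?(ltW c0) // -powRrM mulN1r opprK.
by rewrite powRM ?invr_ge0 ?(ltW c0) // cE; ring.
Qed.

Lemma cvg_Rintegral_dominated (D : set R) (f : nat -> R -> R) (l g : R -> R) (v : nat -> R) :
  measurable D -> (forall n, measurable_fun D (f n)) ->
  (forall s, D s -> f n s @[n --> \oo] --> l s) ->
  mu.-integrable D (EFin \o g) ->
  (forall n s, D s -> 0 <= f n s <= g s) ->
  (forall n, (v n)%:E = \int[mu]_(s in D) (f n s)%:E)%E ->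
  v n @[n --> \oo] --> \int[mu]_(s in D) l s.
Proof.
move=> mD mf fl ig fg vE.
have mEf n : measurable_fun D (EFin \o f n) by exact/measurable_EFinP.
have ml : measurable_fun D (EFin \o l).
  apply/measurable_EFinP; exact: measurable_fun_cvg mf fl.
have fl_ae : {ae mu, forall s, D s ->
    (fun n => (EFin \o f n) s) @ \oo --> (EFin \o l) s}.
  by apply: aeW => s Ds; apply: cvg_EFin; [exact: nearW | exact: fl].
have fg_ae : {ae mu, forall s n, D s -> (`|(EFin \o f n) s| <= (EFin \o g) s)%E}.
  apply: aeW => s n Ds; have /andP[f0 fgs] := fg n s Ds.
  by rewrite /= ger0_norm // lee_fin.
have [il _ lim] := @dominated_convergence _ _ _ mu D mD _ _ _ mEf ml fl_ae ig fg_ae.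
have : (v n)%:E @[n --> \oo] --> (\int[mu]_(s in D) (l s)%:E)%E.
  rewrite (_ : (fun n => _) = fun n => (\int[mu]_(s in D) (EFin \o f n) s)%E) //.
  by apply/funext => n; rewrite vE.
have fin_l : (\int[mu]_(s in D) (l s)%:E)%E \is a fin_num.
  by apply: (integrable_fin_num _ il).
rewrite -(fineK fin_l) => /fine_cvg.
by apply: cvg_trans; apply: near_eq_cvg; exact: nearW.
Qed.

End NegativeMoments.

(** * The three regimes *)
Section Asymptotics.
Context {R : realType} (a : nat -> nat -> R) (sigma gam : R).
Local Notation mu := (@lebesgue_measure R).
Local Notation halfline := (`]0, +oo[%classic : set R).
Let H n x := pgf (a n) x.
Hypotheses (sigma0 : 0 < sigma) (gam0 : 0 < gam).
Hypotheses (a0 : forall n k, 0 <= a n k) (ca : forall n, cvgn (series (a n))).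
Hypothesis a1 : forall n, limn (series (a n)) = 1.
Hypothesis H_cvg : forall x : R, 0 <= x < 1 -> cvgn (fun n => n%:R `^ sigma * H n x).
Hypothesis H_le : exists C : R, 0 < C /\ forall n (x : R), (0 < n)%N -> 0 <= x < 1 ->
  H n x <= C * (n%:R * (1 - x)) `^ (- sigma).
Hypothesis H_diagonal : forall t : nat -> R, (forall n, 0 < t n) ->
  t n @[n --> \oo] --> (0 : R) ->
  H n (expR (- t n)) * (1 + gam * n%:R * t n) `^ sigma @[n --> \oo] --> (1 : R).

(** Discarding the atom at 0 turns the generating function into [H n x - H n 0]. *)
Definition positive_part n k : R := if k is 0 then 0 else a n k.

Definition negative_moment (r : R) n : R :=
  limn (series (fun k => positive_part n k * k%:R `^ (- r))).

Let q := positive_part.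
Let psi n x := pgf (q n) x.

Let q0 n k : 0 <= q n k.
Proof. by case: k => [|k]; [exact: lexx | exact: a0]. Qed.

Let q_le n k : q n k <= a n k.
Proof. by case: k => [|k]; [exact: a0 | exact: lexx]. Qed.

Let cq n : cvgn (series (q n)).
Proof. by apply: is_cvg_series_le (@ca n) => k; rewrite q0 q_le. Qed.

Let expR_neg_01 (t : R) : 0 < t -> 0 <= expR (- t) < 1.
Proof. by move=> t0; have /andP[/ltW -> ->] := expRN_01 t0. Qed.

Let le01 (x : R) : 0 <= x < 1 -> 0 <= x <= 1.
Proof. by move=> /andP[-> /ltW ->]. Qed.

Lemma pgf_positive_part n x : 0 <= x <= 1 -> psi n x = H n x - H n 0.
Proof.
move=> x01; have cH := is_cvg_pgf (a0 n) (@ca n) x01.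
have cpsi := is_cvg_pgf (q0 n) (@cq n) x01.
have [_ E] := sum_shift cH; have [_ E'] := sum_shift cpsi.
move: E E'; rewrite /psi /pgf /= mul0r subr0 => E <-.
by rewrite E expr0 mulr1 /H pgf0.
Qed.

Let psi_ge0 n x : 0 <= x <= 1 -> 0 <= psi n x.
Proof.
move=> x01; have /andP[x0 x1] := x01.
by apply: sum_ge0; [move=> k; rewrite mulr_ge0 // exprn_ge0 | exact: is_cvg_pgf].
Qed.

Let psi_le1 n x : 0 <= x <= 1 -> psi n x <= 1.
Proof.
move=> x01; have /andP[x0 x1] := x01.
rewrite -(a1 n); apply: sum_le => // k; rewrite mulr_ge0 ?exprn_ge0 //=.
apply: le_trans (q_le n k); by rewrite ler_piMr // exprn_ile1.
Qed.

(** On positive integers [x ^ k] is at most [sqrt x * sqrt x ^ k], which buys a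
    factor decaying exponentially in [t] for [x = exp (- t)]. *)
Lemma psi_le : exists K, 0 < K /\ forall n t, (0 < n)%N -> 0 < t ->
  psi n (expR (- t)) <= K * (n%:R * t) `^ (- sigma) * expR (- (4^-1 * t)).
Proof.
have [C [C0 HC]] := H_le.
(* The constant in (1 + u) ^ sigma <= K' exp (u / 2), from powR_le_expR. *)
set K' := (sigma / 2^-1) `^ sigma * expR (2^-1).
have K'0 : 0 < K' by rewrite mulr_gt0 ?expR_gt0 // powR_gt0 // divr_gt0.
exists (C * K' * 2^-1 `^ (- sigma)); split.
  by apply: mulr_gt0; [exact: mulr_gt0 | apply: powR_gt0; rewrite invr_gt0].
move=> n t n0 t0; set u := t / 2.
have u0 : 0 < u by rewrite divr_gt0.
have n0' : (0 : R) < n%:R by rewrite ltr0n.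
have y01 := expR_neg_01 u0; have /andP[y0 y1] := y01.
set y := expR (- u) in y0 y1 y01.
have step1 : psi n (expR (- t)) <= y * H n y.
  rewrite -sumZ; last by apply: is_cvg_pgf => //; exact: le01.
  apply: sum_le; last by apply: is_cvg_sumZ; apply: is_cvg_pgf => //; exact: le01.
  have -> : expR (- t) = y * y by rewrite -expRD; congr expR; rewrite /u; field.
  move=> [|k]; rewrite ?mul0r ?lexx ?mulr_ge0 ?exprn_ge0 ?mulr_ge0 //=.
  rewrite mulrCA ler_wpM2l // exprMn ler_wpM2r ?exprn_ge0 //.
  by rewrite exprS ler_piMr // exprn_ile1 // ltW.
have step2 : H n y <= C * (n%:R * u) `^ (- sigma) * (1 + u) `^ sigma.
  apply: le_trans (HC n y n0 y01) _; rewrite -mulrA ler_wpM2l ?(ltW C0) //.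
  have nu0 : 0 < n%:R * u by rewrite mulr_gt0.
  have u1 : 0 < 1 + u by lra.
  have -> : (1 + u) `^ sigma = ((1 + u)^-1) `^ (- sigma).
    by rewrite -powR_inv1 ?(ltW u1) // -powRrM mulN1r opprK.
  rewrite -powRM ?(ltW nu0) ?invr_ge0 ?(ltW u1) // !powRN.
  have A0 : 0 < n%:R * u / (1 + u) by rewrite divr_gt0.
  have B0 : 0 < n%:R * (1 - y) by rewrite mulr_gt0 // subr_gt0.
  rewrite lef_pV2 ?posrE ?powR_gt0 //.
  apply: (ge0_ler_powR (ltW sigma0)); rewrite ?nnegrE ?(ltW A0) ?(ltW B0) //.
  rewrite -mulrA ler_wpM2l ?(ltW n0') // ler_pdivrMr //.
  have : y * (1 + u) <= 1.
    have := ler_wpM2l y0 (expR_ge1Dx u).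
    by rewrite /y -expRD addNr expR0.
  by nra.
have step3 : (1 + u) `^ sigma <= K' * expR (2^-1 * u).
  have h0 : (0 : R) < 2^-1 by rewrite invr_gt0.
  have u1 : 0 < 1 + u by lra.
  have := powR_le_expR sigma0 h0 u1.
  by rewrite mulrDr mulr1 expRD mulrA.
apply: (le_trans step1); apply: (le_trans (ler_wpM2l y0 step2)).
have P0 : 0 <= C * (n%:R * u) `^ (- sigma) by rewrite mulr_ge0 ?powR_ge0 // ltW.
apply: (le_trans (ler_wpM2l y0 (ler_wpM2l P0 step3))).
rewrite le_eqVlt; apply/orP; left; apply/eqP.
have -> : (n%:R * u) `^ (- sigma) = (n%:R * t) `^ (- sigma) * 2^-1 `^ (- sigma).
  by rewrite -powRM ?mulr_ge0 ?invr_ge0 // ?(ltW t0) // /u mulrA.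
have -> : expR (- (4^-1 * t)) = y * expR (2^-1 * u).
  by rewrite -expRD; congr expR; rewrite /u; field.
by ring.
Qed.

Let expR_div_01 (s c : R) : 0 < s -> 0 < c -> 0 <= expR (- (s / c)) < 1.
Proof. by move=> s0 c0; apply: expR_neg_01; rewrite divr_gt0. Qed.

Let moment_integral n r c : 0 < r -> 0 < c ->
  ((Gamma r * (c `^ r * negative_moment r n))%:E =
   \int[mu]_(s in halfline) (laplace_density (q n) r c s)%:E)%E.
Proof. by move=> r0 c0; apply: negative_moment_integral. Qed.

Let laplace_ge0 n r c s : 0 < c -> 0 < s -> 0 <= laplace_density (q n) r c s.
Proof. by move=> c0 s0; exact: laplace_density_ge0. Qed.

Let measurable_laplace n r c : 0 < c ->
  measurable_fun halfline (laplace_density (q n) r c).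
Proof. by move=> c0; exact: measurable_laplace_density. Qed.

Let halflineE (s : R) : halfline s -> 0 < s.
Proof. by rewrite /= in_itv /= andbT. Qed.

Lemma H0_cvg0 (p : R) : 0 <= p < sigma ->
  n%:R `^ p * H n 0 @[n --> \oo] --> (0 : R).
Proof.
move=> /andP[p0 ps]; have [C [C0 HC]] := H_le.
have bound : n%:R `^ p * H n 0 @[n --> \oo] --> (0 : R).
  have lim : C * n%:R `^ (- (sigma - p)) @[n --> \oo] --> (0 : R).
    rewrite -[X in _ --> X](mulr0 C); apply: cvgM; first exact: cvg_cst.
    have sp : 0 < sigma - p by lra.
    exact: (cvg_comp _ _ (@cvgr_idn R) (cvg_powR_pinfty sp)).
  apply: (squeeze_cvgr _ (cvg_cst (0 : R)) lim).
  near=> n; have n0 : (0 < n)%N by near: n; exact: nbhs_infty_gt.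
  have n0' : (0 : R) < n%:R by rewrite ltr0n.
  have H0 : 0 <= H n 0 by rewrite /H pgf0.
  rewrite mulr_ge0 ?powR_ge0 //=.
  have z01 : 0 <= (0 : R) < 1 by rewrite lexx ltr01.
  have := ler_wpM2l (powR_ge0 n%:R p) (HC n 0 n0 z01).
  rewrite subr0 mulr1 => /le_trans; apply.
  by rewrite mulrCA -powRD ?(gt_eqF n0') ?implybT // opprB.
exact: bound.
Unshelve. all: by end_near.
Qed.

Let H0_cvg : H n 0 @[n --> \oo] --> (0 : R).
Proof.
have := @H0_cvg0 0; rewrite lexx sigma0 => /(_ isT); apply: cvg_trans.
by apply: near_eq_cvg; apply: nearW => n; rewrite powRr0 mul1r.
Qed.

Let cvg_Gamma_cancel (r : R) (v : nat -> R) (l : R) : 0 < r ->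
  Gamma r * v n @[n --> \oo] --> l -> v n @[n --> \oo] --> (Gamma r)^-1 * l.
Proof.
move=> r0 lim; have G0 := Gamma_gt0 r0.
have : (Gamma r)^-1 * (Gamma r * v n) @[n --> \oo] --> (Gamma r)^-1 * l.
  by apply: cvgM; [exact: cvg_cst | exact: lim].
apply: cvg_trans; apply: near_eq_cvg; apply: nearW => n.
by rewrite mulKf // gt_eqF.
Qed.

Definition scaled_pgf_limit (x : R) : R := limn (fun n => n%:R `^ sigma * H n x).

(** Dominated by a multiple of [gamma_density (r - sigma) 4^-1], which is
    integrable because [sigma < r]. *)
Lemma negative_moment_limit_above (r : R) : sigma < r ->
  n%:R `^ sigma * negative_moment r n @[n --> \oo] -->
  (Gamma r)^-1 * \int[mu]_(t in halfline) ((scaled_pgf_limit (expR (- t)) - scaled_pgf_limit 0) * t `^ (r - 1)).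
Proof.
move=> sr; have r0 : 0 < r := lt_trans sigma0 sr.
have [K [K0 HK]] := psi_le.
pose f (n : nat) s := n%:R `^ sigma * laplace_density (q n) r 1 s.
have lim : Gamma r * (n%:R `^ sigma * negative_moment r n) @[n --> \oo] -->
    \int[mu]_(t in halfline) ((scaled_pgf_limit (expR (- t)) - scaled_pgf_limit 0) * t `^ (r - 1)).
  apply: (@cvg_Rintegral_dominated _ _ f _ (fun s => K * gamma_density (r - sigma) 4^-1 s)).
  - exact: measurable_itv.
  - by move=> n; apply: measurable_funM => //; exact: measurable_laplace.
  - move=> s /halflineE s0; rewrite /f /laplace_density.
    have e01 := expR_neg_01 s0; have z01 : 0 <= (0 : R) < 1 by rewrite lexx ltr01.
    have lim1 : (n%:R `^ sigma * H n (expR (- s)) - n%:R `^ sigma * H n 0) *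
        s `^ (r - 1) @[n --> \oo] --> (scaled_pgf_limit (expR (- s)) - scaled_pgf_limit 0) * s `^ (r - 1).
      apply: cvgM; last exact: cvg_cst.
      by apply: cvgB; [exact: H_cvg e01 | exact: H_cvg z01].
    apply: cvg_trans lim1; apply: near_eq_cvg; apply: nearW => n /=.
    by rewrite divr1 -/(psi n _) pgf_positive_part ?le01 //; ring.
  - have ig : mu.-integrable halfline (EFin \o gamma_density (r - sigma) 4^-1).
      by apply: integrable_gamma_density; [lra | rewrite invr_gt0].
    rewrite (_ : EFin \o _ =
        (fun s => K%:E * (EFin \o gamma_density (r - sigma) 4^-1) s)%E) //.
    by apply: integrableZl.
  - move=> n s /halflineE s0; rewrite /f mulr_ge0 ?powR_ge0 ?laplace_ge0 //=.
    (* At index 0 the factor 0 `^ sigma vanishes. *)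
    case: n => [|n].
      by rewrite powR0 ?gt_eqF // mul0r mulr_ge0 ?gamma_density_ge0 // ltW.
    have /(ler_wpM2l (powR_ge0 n.+1%:R sigma)) := HK n.+1 s isT s0.
    rewrite /laplace_density divr1 -/(psi _ _) => /(ler_wpM2r (powR_ge0 s (r - 1))).
    rewrite mulrA => /le_trans; apply; rewrite le_eqVlt; apply/orP; left; apply/eqP.
    rewrite /gamma_density powRM ?(ltW s0) //.
    have -> : s `^ (r - sigma - 1) = s `^ (- sigma) * s `^ (r - 1).
      by rewrite -powRD ?(gt_eqF s0) ?implybT //; congr (_ `^ _); ring.
    have E : n.+1%:R `^ sigma * n.+1%:R `^ (- sigma) = 1 :> R.
      by rewrite powRN divff // gt_eqF // powR_gt0.
    transitivity (n.+1%:R `^ sigma * n.+1%:R `^ (- sigma) *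
      (K * (s `^ (- sigma) * s `^ (r - 1) * expR (- (4^-1 * s))))); first by ring.
    by rewrite E mul1r.
  - move=> n.
    have M1 : negative_moment r n = 1 `^ r * negative_moment r n by rewrite powR1 mul1r.
    rewrite mulrCA EFinM M1 moment_integral // -ge0_integralZl_EFin ?powR_ge0 //.
    + by move=> s /halflineE s0; rewrite lee_fin laplace_ge0.
    + by apply/measurable_EFinP; exact: measurable_laplace.
exact: cvg_Gamma_cancel r0 lim.
Qed.

Let H_diagonal_shift (m : nat) (t : nat -> R) : (forall n, 0 < t n) ->
  t n @[n --> \oo] --> (0 : R) ->
  H (n + m) (expR (- t n)) * (1 + gam * (n + m)%:R * t n) `^ sigma @[n --> \oo] -->
    (1 : R).
Proof.
move=> t0 tlim; pose t' n := t (n - m)%N.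
have t'lim : t' n @[n --> \oo] --> (0 : R).
  rewrite -(cvg_shiftn m); apply: cvg_trans tlim; apply: near_eq_cvg.
  by apply: nearW => n; rewrite /= /t' addnK.
have := H_diagonal (fun n => t0 (n - m)%N) t'lim.
rewrite -(cvg_shiftn m); apply: cvg_trans; apply: near_eq_cvg.
by apply: nearW => n; rewrite /= /t' addnK.
Qed.

Let psi_le_powR : exists K, 0 < K /\ forall n s, (0 < n)%N -> 0 < s ->
  psi n (expR (- (s / n%:R))) <= K * s `^ (- sigma) * expR (- (4^-1 * (s / n%:R))).
Proof.
have [K [K0 HK]] := psi_le; exists K; split => // n s n0 s0.
have n0' : (0 : R) < n%:R by rewrite ltr0n.
have := HK n (s / n%:R) n0 (divr_gt0 s0 n0').
by rewrite mulrCA divff ?mulr1 // gt_eqF.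
Qed.

(** After rescaling by [n], the integrand is dominated by [s `^ (r - 1)] near 0
    and by [s `^ (r - 1 - sigma)] near infinity. *)
Lemma negative_moment_limit_below (r : R) : 0 < r -> r < sigma ->
  n%:R `^ r * negative_moment r n @[n --> \oo] -->
  (Gamma r)^-1 * \int[mu]_(s in halfline) ((1 + gam * s) `^ (- sigma) * s `^ (r - 1)).
Proof.
move=> r0 rs; have [K [K0 HK]] := psi_le_powR.
rewrite -(cvg_shiftn 1); apply: (cvg_Gamma_cancel r0).
pose f (n : nat) s := laplace_density (q (n + 1)) r (n + 1)%:R s.
pose g (s : R) := Num.min 1 (K * s `^ (- sigma)) * s `^ (r - 1).
have n0 n : (0 < n + 1)%N by rewrite addn1.
have n0' n : (0 : R) < (n + 1)%:R by rewrite ltr0n.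
have g0 s : 0 <= g s.
  by rewrite mulr_ge0 ?powR_ge0 // le_min ler01 mulr_ge0 ?powR_ge0 // ltW.
apply: (@cvg_Rintegral_dominated _ _ f _ g).
- exact: measurable_itv.
- by move=> n; exact: measurable_laplace.
- move=> s /halflineE s0.
  have s1 : 0 < 1 + gam * s by rewrite ltr_pwDl // mulr_ge0 // ltW.
  pose t n := s / (n + 1)%:R.
  have tlim : t n @[n --> \oo] --> (0 : R).
    rewrite -[X in _ --> X](mulr0 s); apply: cvgM; first exact: cvg_cst.
    apply: cvg_trans (@cvg_harmonic R); apply: near_eq_cvg; apply: nearW => n.
    by rewrite /= addn1.
  have lim1 := @H_diagonal_shift 1 t (fun n => divr_gt0 s0 (n0' n)) tlim.
  have lim2 : H (n + 1) (expR (- t n)) @[n --> \oo] --> (1 + gam * s) `^ (- sigma).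
    have : (1 + gam * s) `^ (- sigma) *
        (H (n + 1) (expR (- t n)) * (1 + gam * (n + 1)%:R * t n) `^ sigma)
        @[n --> \oo] --> (1 + gam * s) `^ (- sigma) * 1.
      by apply: cvgM; [exact: cvg_cst | exact: lim1].
    rewrite mulr1; apply: cvg_trans; apply: near_eq_cvg; apply: nearW => n.
    have -> : gam * (n + 1)%:R * t n = gam * s.
      by rewrite /t; field; rewrite gt_eqF.
    by rewrite powRN mulrCA mulVf ?mulr1 // gt_eqF // powR_gt0.
  have lim3 : H (n + 1) 0 @[n --> \oo] --> (0 : R).
    by rewrite (cvg_shiftn 1 (H ^~ 0)).
  have lim4 : (H (n + 1) (expR (- t n)) - H (n + 1) 0) * s `^ (r - 1) @[n --> \oo] -->
      ((1 + gam * s) `^ (- sigma) - 0) * s `^ (r - 1).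
    by apply: cvgM; [exact: cvgB | exact: cvg_cst].
  rewrite subr0 in lim4; apply: cvg_trans lim4; apply: near_eq_cvg.
  apply: nearW => n; rewrite /f /laplace_density -/(psi (n + 1) _).
  by rewrite pgf_positive_part // le01 // expR_div_01.
- apply: (@integrable_halfline _ g r (1 + sigma - r) (1 + K)) => //; first by lra.
  + apply: measurable_funM; last exact: measurable_powRl.
    apply: measurable_minr => //; apply: measurable_funM => //.
    exact: measurable_powRl.
  + move=> s s0 _; rewrite ler_wpM2r ?powR_ge0 // ge_min; apply/orP; left; lra.
  + move=> s s1; have s0 : 0 < s by exact: lt_le_trans s1.
    have -> : - (1 + sigma - r) = - sigma + (r - 1) by ring.
    rewrite powRD ?(gt_eqF s0) ?implybT // mulrA ler_wpM2r ?powR_ge0 //.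
    rewrite ge_min; apply/orP; right; rewrite ler_wpM2r ?powR_ge0 //; lra.
- move=> n s /halflineE s0; rewrite laplace_ge0 //= ler_wpM2r ?powR_ge0 //.
  rewrite le_min psi_le1 ?le01 ?expR_div_01 //=.
  apply: le_trans (HK _ _ (n0 n) s0) _; rewrite ler_piMr ?mulr_ge0 ?powR_ge0 ?(ltW K0) //.
  by rewrite expR_le1 oppr_le0 mulr_ge0 ?invr_ge0 // divr_ge0 // ltW.
- by move=> n; exact: moment_integral.
Qed.

(** Between 1 and [n] the rescaled integrand is about [gam `^ (- sigma) / s], so it
    contributes [gam `^ (- sigma) * ln n]; the ranges [s <= 1] and [s > n]
    contribute bounded amounts. *)
Lemma negative_moment_limit_at :
  n%:R `^ sigma / ln n%:R * negative_moment sigma n @[n --> \oo] -->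
  (Gamma sigma)^-1 * gam `^ (- sigma).
Proof.
have [K [K0 HK]] := psi_le_powR.
(* Starting at index 2 makes every logarithm positive. *)
rewrite -(cvg_shiftn 2); apply: (cvg_Gamma_cancel sigma0).
pose N n : R := (n + 2)%:R.
pose L n := ln (N n).
have n0 n : (0 < n + 2)%N by rewrite addn2.
have N1 n : 1 < N n by rewrite ltr1n addn2.
have N0 n : 0 < N n by exact: lt_trans (N1 n).
have L0 n : 0 < L n by exact: ln_gt0.
pose G n := laplace_density (q (n + 2)) sigma (N n).
pose phi n v := (N n `^ v) `^ sigma * psi (n + 2) (expR (- (N n `^ v / N n))).
have F0 n v : 0 < N n `^ v by exact: powR_gt0.
have psi_bound n s : 0 < s -> psi (n + 2) (expR (- (s / N n))) <=
    K * s `^ (- sigma) * expR (- (4^-1 * (s / N n))) by move=> s0; exact: HK.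
have psi_bound' n s : 0 < s -> psi (n + 2) (expR (- (s / N n))) <= K * s `^ (- sigma).
  move=> s0; apply: le_trans (psi_bound n s s0) _.
  rewrite ler_piMr ?mulr_ge0 ?powR_ge0 ?(ltW K0) //.
  by rewrite expR_le1 oppr_le0 mulr_ge0 ?invr_ge0 // divr_ge0 ?(ltW s0) ?(ltW (N0 n)).
have phi0 n v : 0 <= phi n v.
  by rewrite mulr_ge0 ?powR_ge0 // psi_ge0 // le01 // expR_div_01.
have phiK n v : phi n v <= K.
  have := ler_wpM2l (powR_ge0 (N n `^ v) sigma) (psi_bound' n _ (F0 n v)).
  move=> /le_trans; apply; rewrite mulrCA powRN divff ?mulr1 //.
  by rewrite gt_eqF // powR_gt0.
have mG n : measurable_fun halfline (G n) by exact: measurable_laplace.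
have G0 n s : 0 < s -> 0 <= G n s by move=> s0; exact: laplace_ge0.
have mGS n (D : set R) : D `<=` halfline -> measurable_fun D (EFin \o G n).
  move=> DH; apply/measurable_EFinP; exact: measurable_funS (mG n).
have I1 n : (\int[mu]_(s in `]0%R, 1%R]) (G n s)%:E <= (sigma^-1)%:E)%E.
  have sub : `]0, 1]%classic `<=` halfline.
    by move=> s /=; rewrite !in_itv /= => /andP[->].
  apply: le_trans (integral_powR_01 sigma0).
  apply: ge0_le_integral; first exact: measurable_itv.
  - by move=> s /sub/halflineE s0; rewrite lee_fin G0.
  - exact: mGS.
  - by apply/measurable_EFinP; exact: measurable_powRl.
  - move=> s /sub/halflineE s0; rewrite lee_fin /G /laplace_density.
    by rewrite ler_piMl ?powR_ge0 // psi_le1 // le01 // expR_div_01.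
(* Beyond n the exponential factor is bounded by 4 n / s, which leaves n / s ^ 2. *)
have I3 n : (\int[mu]_(s in `](N n), +oo[) (G n s)%:E <= (4 * K)%:E)%E.
  have sub : `](N n), +oo[%classic `<=` halfline.
    by move=> s /=; rewrite !in_itv /= !andbT; exact: lt_trans.
  have C0 : 0 <= 4 * K * N n by rewrite !mulr_ge0 // ltW.
  apply: (@le_trans _ _ (\int[mu]_(s in `](N n), +oo[)
      ((4 * K * N n)%:E * (s `^ (- 2))%:E))%E).
    apply: ge0_le_integral; first exact: measurable_itv.
    - by move=> s /sub/halflineE s0; rewrite lee_fin G0.
    - exact: mGS.
    - apply: measurable_funeM; apply/measurable_EFinP; exact: measurable_powRl.
    - move=> s /sub/halflineE s0; rewrite -EFinM lee_fin /G /laplace_density.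
      have := ler_wpM2r (powR_ge0 s (sigma - 1)) (psi_bound n s s0).
      move=> /le_trans; apply.
      have u0 : 0 < 4^-1 * (s / N n) by rewrite mulr_gt0 ?invr_gt0 ?divr_gt0.
      have eu : expR (- (4^-1 * (s / N n))) <= 4 * N n / s.
        have -> : 4 * N n / s = (4^-1 * (s / N n))^-1.
          by field; rewrite !gt_eqF.
        rewrite expRN lef_pV2 ?posrE ?expR_gt0 //.
        by apply: le_trans (expR_ge1Dx _); rewrite lerDr.
      have -> : s `^ (- 2) = s `^ (- sigma) * s `^ (sigma - 1) / s.
        rewrite -powR_inv1 ?(ltW s0) // -!powRD ?(gt_eqF s0) ?implybT //.
        by congr (_ `^ _); ring.
      have P0 : 0 <= K * s `^ (- sigma) * s `^ (sigma - 1).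
        by rewrite !mulr_ge0 ?powR_ge0 // ltW.
      have := ler_wpM2l P0 eu.
      rewrite (_ : _ * (4 * N n / s) =
        4 * K * N n * (s `^ (- sigma) * s `^ (sigma - 1) / s)); last by ring.
      by apply: le_trans; rewrite le_eqVlt; apply/orP; left; apply/eqP; ring.
  rewrite ge0_integralZl_EFin //; last 2 first.
  - by move=> s _; rewrite lee_fin powR_ge0.
  - by apply/measurable_EFinP; exact: measurable_powRl.
  rewrite integral_itv_obnd_cbnd; last first.
    by apply/measurable_EFinP; exact: measurable_powRl.
  rewrite integral_powR_tail //; last by lra.
  rewrite -EFinM lee_fin (_ : 1 - 2 = - 1 :> R); last by ring.
  rewrite powR_inv1 ?(ltW (N0 n)) // le_eqVlt; apply/orP; left; apply/eqP.
  by field; rewrite gt_eqF.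
have phiE n v : phi n v = N n `^ v * G n (N n `^ v).
  by rewrite /phi /psi /G /laplace_density -(mulr_powRB1 (ltW (F0 n v)) sigma0); ring.
have powN n : powR (N n) = (fun v => expR (v * L n)).
  by apply/funext => v; rewrite /powR gt_eqF.
have cF n v : {for v, continuous (powR (N n))}.
  rewrite powN; apply: continuous_comp; last exact: continuous_expR.
  exact: mulrr_continuous.
have cG n s : 0 < s -> {for s, continuous (G n)}.
  by move=> s0; exact: continuous_laplace_density.
have cphi n v : {for v, continuous (phi n)}.
  have -> : phi n = (fun v => N n `^ v * G n (N n `^ v)) by apply/funext => w; exact: phiE.
  apply: cvgM; first exact: cF.
  suff : {for v, continuous (G n \o powR (N n))} by [].
  by apply: continuous_comp; [exact: cF | exact: cG].
have mphi n (D : set R) : measurable_fun D (phi n).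
  by apply: measurable_funTS; apply: continuous_measurable_fun => v; exact: cphi.
(* The substitution s = n ^ v turns ds / s into ln n dv. *)
have I2 n : (\int[mu]_(s in `]1%R, (N n)]) (G n s)%:E =
    (L n)%:E * \int[mu]_(v in `]0%R, 1%R[) (phi n v)%:E)%E.
  have sub : `]1, N n]%classic `<=` halfline.
    by move=> s /=; rewrite !in_itv /= andbT => /andP[s1 _]; exact: lt_trans s1.
  have dF v : is_derive v (1 : R) (powR (N n)) (L n * N n `^ v).
    rewrite powN; apply: is_derive_eq; rewrite /GRing.scale /=; ring.
  have dFE : (powR (N n))^`()%classic = (fun v => L n * N n `^ v).
    by apply/funext => v; rewrite derive1E derive_val.
  have cdF v : {for v, continuous (fun v => L n * N n `^ v)}.
    by apply: cvgM; [exact: cvg_cst | exact: cF].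
  rewrite integral_itv_obnd_cbnd; last exact: mGS.
  have FE0 : N n `^ 0 = 1 by rewrite powRr0.
  have FE1 : N n `^ 1 = N n by rewrite powRr1 // ltW.
  rewrite -{1}FE0 -{2}FE1.
  rewrite (@integration_by_substitution_increasing _ (powR (N n)) (G n)) //.
  - rewrite -(@integral_itv_bndoo _ 0 1 (EFin \o phi n) true false); last first.
      by apply/measurable_EFinP; exact: mphi.
    rewrite -ge0_integralZl_EFin ?(ltW (L0 n)) //.
    + apply: eq_integral => v _; rewrite /= phiE dFE -EFinM; congr (_%:E).
      by rewrite !fctE /=; ring.
    + by move=> v _; rewrite /= lee_fin.
    + by apply/measurable_EFinP; exact: mphi.
  - by move=> u v _ _ uv; rewrite powN ltr_expR ltr_pM2r.
  - by rewrite dFE => v _; exact: cdF.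
  - rewrite dFE; apply: cvgP; apply: cvg_at_right_filter; exact: cdF.
  - rewrite dFE; apply: cvgP; apply: cvg_at_left_filter; exact: cdF.
  - split.
    + by move=> v _; exact: ex_derive.
    + by apply: cvg_at_right_filter; exact: cF.
    + by apply: cvg_at_left_filter; exact: cF.
  - rewrite FE0 FE1; apply: continuous_in_subspaceT => s /[!inE] /=.
    by rewrite in_itv /= => /andP[s1 _]; apply: cG; exact: lt_le_trans s1.
have unit_len : (mu `]0%R, 1%R[ = 1)%E.
  by rewrite lebesgue_measure_itv /= lte_fin ltr01 oppr0 adde0.
have fin_phi n : (\int[mu]_(v in `]0%R, 1%R[) (phi n v)%:E)%E \is a fin_num.
  rewrite ge0_fin_numE; last by apply: integral_ge0 => v _; rewrite lee_fin.
  apply: (@le_lt_trans _ _ (\int[mu]_(v in `]0%R, 1%R[) K%:E)%E).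
    apply: ge0_le_integral; first exact: measurable_itv.
    - by move=> v _; rewrite lee_fin.
    - by apply/measurable_EFinP; exact: mphi.
    - exact: measurable_cst.
    - by move=> v _; rewrite lee_fin.
  by rewrite integral_cst //= unit_len mule1 ltry.
pose J n := fine (\int[mu]_(v in `]0%R, 1%R[) (phi n v)%:E)%E.
have N_lim (p : R) : 0 < p -> N n `^ (- p) @[n --> \oo] --> (0 : R).
  move=> p0; rewrite (cvg_shiftn 2 (fun n => n%:R `^ (- p))).
  exact: (cvg_comp _ _ (@cvgr_idn R) (cvg_powR_pinfty p0)).
have phi_lim v : 0 < v -> v < 1 -> phi n v @[n --> \oo] --> gam `^ (- sigma).
  move=> v0 v1.
  pose t n := N n `^ v / N n.
  have tE n : t n = N n `^ (- (1 - v)).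
    rewrite /t -powR_inv1 ?(ltW (N0 n)) // -powRD ?(gt_eqF (N0 n)) ?implybT //.
    by congr (_ `^ _); ring.
  have tlim : t n @[n --> \oo] --> (0 : R).
    rewrite (_ : t = fun n => N n `^ (- (1 - v))); last by apply/funext.
    by apply: N_lim; rewrite subr_gt0.
  have t0 n : 0 < t n by rewrite divr_gt0.
  have lim1 := @H_diagonal_shift 2 t t0 tlim.
  have lim2 : (N n `^ (- v) + gam) `^ (- sigma) @[n --> \oo] --> (0 + gam) `^ (- sigma).
    have hc : {for (0 + gam), continuous (@powR R ^~ (- sigma))}.
      by apply: continuous_powR; rewrite add0r.
    have inner : N n `^ (- v) + gam @[n --> \oo] --> 0 + gam.
      by apply: cvgD; [exact: N_lim | exact: cvg_cst].
    exact: (cvg_comp _ _ inner hc).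
  rewrite add0r in lim2.
  have lim3 : N n `^ (v * sigma) * H (n + 2) 0 @[n --> \oo] --> (0 : R).
    rewrite (cvg_shiftn 2 (fun n => n%:R `^ (v * sigma) * H n 0)).
    by apply: H0_cvg0; rewrite mulr_ge0 ?(ltW v0) ?(ltW sigma0) //= gtr_pMl.
  have lim4 : H (n + 2) (expR (- t n)) * (1 + gam * N n * t n) `^ sigma *
      (N n `^ (- v) + gam) `^ (- sigma) - N n `^ (v * sigma) * H (n + 2) 0
      @[n --> \oo] --> 1 * gam `^ (- sigma) - 0.
    by apply: cvgB; [exact: cvgM | exact: lim3].
  rewrite mul1r subr0 in lim4; apply: cvg_trans lim4; apply: near_eq_cvg.
  apply: nearW => n /=; rewrite /phi pgf_positive_part; last by rewrite le01 // expR_div_01.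
  have E : (1 + gam * N n * t n) `^ sigma * (N n `^ (- v) + gam) `^ (- sigma) =
      (N n `^ v) `^ sigma.
    have -> : 1 + gam * N n * t n = N n `^ v * (N n `^ (- v) + gam).
      rewrite mulrDr powRN divff ?gt_eqF // /t; congr (_ + _).
      by field; rewrite gt_eqF.
    have A0 : 0 < N n `^ (- v) + gam by rewrite addr_gt0 // powR_gt0.
    rewrite powRM ?powR_ge0 ?(ltW A0) // powRN -mulrA divff ?mulr1 //.
    by rewrite gt_eqF // powR_gt0.
  by rewrite -mulrA E powRrM /t; ring.
have J_lim : J n @[n --> \oo] --> gam `^ (- sigma).
  have := @cvg_Rintegral_dominated _ `]0, 1[%classic phi (fun=> gam `^ (- sigma)) (fun=> K) J.
  rewrite Rintegral_cst //= unit_len /= mulr1; apply => //.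
  - by move=> v /=; rewrite in_itv /= => /andP[]; exact: phi_lim.
  - apply/integrableP; split; first exact: measurable_cst.
    rewrite integral_cst //= unit_len mule1 ltry //.
  - by move=> n v _; rewrite phi0 phiK.
  - by move=> n; rewrite fineK.
have bounds n : J n <= Gamma sigma * (N n `^ sigma / L n * negative_moment sigma (n + 2)) <=
    J n + (sigma^-1 + 4 * K) / L n.
  have := moment_integral (n + 2) sigma0 (N0 n); rewrite -/(G n).
  have mEG : measurable_fun halfline (EFin \o G n) by exact: mGS.
  have EG0 s : 0 < s -> (0 <= (EFin \o G n) s)%E by move=> s0; rewrite lee_fin G0.
  have EG0' s : 1 < s -> (0 <= (EFin \o G n) s)%E.
    by move=> s1; apply: EG0; exact: lt_trans s1.
  have mEG' : measurable_fun (`]1, +oo[%classic : set R) (EFin \o G n).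
    by apply: mGS => s /=; rewrite !in_itv /= !andbT; exact: lt_trans.
  have := ge0_integral_split ler01 mEG EG0.
  have -> := ge0_integral_split (ltW (N1 n)) mEG' EG0'.
  rewrite /= I2 -(fineK (fin_phi n)) -/(J n).
  have A0 : (0 <= \int[mu]_(s in `]0%R, 1%R]) (G n s)%:E)%E.
    apply: integral_ge0 => s /=; rewrite in_itv /= => /andP[s0 _].
    by rewrite lee_fin G0.
  have B0 : (0 <= \int[mu]_(s in `](N n), +oo[) (G n s)%:E)%E.
    apply: integral_ge0 => s /=; rewrite in_itv /= andbT => s0.
    by rewrite lee_fin G0 // (lt_trans (N0 n)).
  have := I1 n; have := I3 n; move: A0 B0.
  set A := (\int[mu]_(s in `]0%R, 1%R]) (G n s)%:E)%E.
  set B := (\int[mu]_(s in `](N n), +oo[) (G n s)%:E)%E.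
  case: A => [A| |] //; case: B => [B| |] //.
  rewrite -!EFinM -!EFinD !lee_fin => A0 B0 B1 A1 -> /eqP; rewrite eqe => /eqP E.
  have -> : Gamma sigma * (N n `^ sigma / L n * negative_moment sigma (n + 2)) =
      J n + (A + B) / L n.
    have -> : Gamma sigma * (N n `^ sigma / L n * negative_moment sigma (n + 2)) =
      Gamma sigma * (N n `^ sigma * negative_moment sigma (n + 2)) / L n by ring.
    by rewrite E; field; rewrite gt_eqF.
  rewrite lerDl divr_ge0 ?addr_ge0 ?(ltW (L0 n)) //=.
  by rewrite lerD2l ler_wpM2r ?invr_ge0 ?(ltW (L0 n)) // lerD.
have rest_lim : J n + (sigma^-1 + 4 * K) / L n @[n --> \oo] --> gam `^ (- sigma).
  rewrite -[X in _ --> X]addr0; apply: cvgD => //.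
  rewrite -[X in _ --> X](mulr0 (sigma^-1 + 4 * K)).
  apply: cvgM; first exact: cvg_cst.
  apply/cvgrPdist_le => e e0; near=> n.
  rewrite sub0r normrN ger0_norm ?invr_ge0 ?(ltW (L0 n)) //.
  rewrite -[leRHS]invrK lef_pV2 ?posrE ?invr_gt0 // /L.
  rewrite -[leLHS]expRK ler_ln ?posrE ?expR_gt0 //.
  apply: (@le_trans _ _ n%:R); last by rewrite ler_nat leq_addr.
  by near: n; exact: nbhs_infty_ger.
apply: (squeeze_cvgr _ J_lim rest_lim); exact: nearW.
Unshelve. all: by end_near.
Qed.

End Asymptotics.

(** * The conditional negative moment *)
Section ConditionalExpectation.
Context d (T : measurableType d) (R : realType) (P : probability T R).
Context (p h : nat -> R).
Context (xi : nat -> nat -> {RV P >-> nat}) (Y : nat -> {RV P >-> nat}).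
Hypothesis inputs : gwi_inputs p h xi Y.
Let Z := gwi xi Y.
Let a := gwi_pmf xi Y.

Lemma cond_expectation_gwi n (r : R) : 0 < r ->
  cond_expectation P (fun w => (Z n w)%:R `^ (- r)) [set w | (0 < Z n w)%N] =
  negative_moment a r n / (1 - a n 0).
Proof.
move=> r0; have [a0 ca a1] := gwi_pmf_ge0_sum1 inputs n.
have mZ : measurable_fun [set: T] (Z n) := measurable_gwi inputs n.
have mpos : measurable [set w | (0 < Z n w)%N].
  by rewrite -[X in measurable X]setTI; exact: (mZ measurableT [set k | (0 < k)%N]).
have q0 k : 0 <= positive_part a n k.
  by case: k => [|k]; [exact: lexx | exact: a0].
have cq : cvgn (series (positive_part a n)).
  by apply: is_cvg_series_le ca => -[|k]; rewrite q0 //=; exact: a0.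
have cm : cvgn (series (fun k => positive_part a n k * k%:R `^ (- r))).
  exact: is_cvg_negative_moment.
have fiber k : P ([set w | (0 < Z n w)%N] `&` Z n @^-1` [set k]) =
    (positive_part a n k)%:E.
  case: k => [|k] /=.
    rewrite (_ : _ `&` _ = set0) ?measure0 //.
    by apply/seteqP; split => // w /= [+ Zw]; rewrite Zw.
  rewrite (EFin_gwi_pmf inputs) (_ : _ `&` _ = Z n @^-1` [set k.+1]) //.
  by apply/seteqP; split => [w []//|w /= Zw]; rewrite Zw; split.
congr (_ / _).
  rewrite /Rintegral (integral_comp_nat P mpos mZ (fun k => powR_ge0 k%:R (- r))).
  rewrite /negative_moment -[LHS]/(fine _).
  under eq_eseriesr do rewrite fiber -EFinM mulrC.
  by rewrite -EFin_sum // => k; rewrite mulr_ge0 ?powR_ge0.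
have -> : [set w | (0 < Z n w)%N] = ~` (Z n @^-1` [set 0%N]).
  by apply/seteqP; split => w /=; rewrite lt0n => /eqP.
rewrite probability_setC; last by have [] := indep_gwi inputs n 0.
by rewrite -(EFin_gwi_pmf inputs) -EFinB.
Qed.

End ConditionalExpectation.

Theorem theorem1p1 (R : realType) (d : measure_display)
    (T : measurableType d) (P : probability T R) (p h : nat -> R)
    (xi : nat -> nat -> {RV P >-> nat}) (Y : nat -> {RV P >-> nat})
    (inputs : gwi_inputs p h xi Y)
    (A : condition_A 'E_P[fun w => (xi 0%N 0%N w)%:R] p h)
    (r : R) (r_gt0 : 0 < r) :
  let Z := gwi xi Y in
  let sigma := gwi_sigma p h in
  let gamma := fine (gwi_gamma p) in
  norming sigma n r *
    cond_expectation P (fun w => (Z n w)%:R `^ (- r))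
      [set w | (0 < Z n w)%N]
    @[n --> \oo] --> limit_constant (gwi_U P Z sigma) gamma r sigma.
Proof.
move=> Z sigma gamma.
have [p0 cp p1] := pmf_ge0_sum1 (gwi_offspring inputs 0 0).
have [h0 ch h1] := pmf_ge0_sum1 (gwi_immigration inputs 0).
case: A => _ pp hp.
rewrite (pmf_mean (gwi_offspring inputs 0 0)) => mean1 beta_bounds gam_bounds cpl ch2.
have pk0 k : 0 <= p k * k%:R by rewrite mulr_ge0.
have cpm : cvgn (series (fun k => p k * k%:R)).
  by apply: is_cvg_sum_lty => //; rewrite mean1 ltry.
have pm : limn (series (fun k => p k * k%:R)) = 1.
  by apply/eqP; rewrite -eqe EFin_sum // mean1.
have cvg_from1 (v : nat -> R) : (forall k, 0 <= v k) -> v 0%N = 0 ->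
    (\sum_(1 <= j <oo) (v j)%:E < +oo)%E -> cvgn (series v).
  move=> v0 v00 vlt; apply: is_cvg_sum_lty => //.
  rewrite (nneseries_split 0 1) ?add0n; last by move=> k _; rewrite lee_fin.
  by rewrite big_nat1 v00 add0e.
have ln0 k : 0 <= ln (k%:R : R).
  case: k => [|k]; last by apply: ln_ge0; rewrite ler1n.
  by rewrite ln0.
have {}cpl : cvgn (series (fun k => p k * k%:R ^+ 2 * ln k%:R)).
  apply: cvg_from1 => //; last by rewrite expr0n mulr0 mul0r.
  by move=> k; rewrite !mulr_ge0 // sqr_ge0.
have {}ch2 : cvgn (series (fun k => h k * k%:R ^+ 2)).
  apply: cvg_from1 => //; last by rewrite expr0n mulr0.
  by move=> k; rewrite mulr_ge0 // sqr_ge0.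
have cp2 := is_cvg_second_moment p0 cp cpl.
have chm := is_cvg_first_moment_of_second h0 ch2.
have betaE : gwi_beta h = (immigration_mean h)%:E by exact: derive_at_1_pgf1.
have gammaE : gwi_gamma p = (half_variance p)%:E.
  rewrite /gwi_gamma derive_at_1_pgf2 // -EFinM mulrA mulVf ?mul1r //.
have immigration_mean_gt0 : 0 < immigration_mean h by move: beta_bounds; rewrite betaE lte_fin => /andP[].
have gam0 : 0 < half_variance p by move: gam_bounds; rewrite gammaE lte_fin => /andP[].
have -> : gamma = half_variance p by rewrite /gamma gammaE.
have sigmaE : sigma = immigration_mean h / half_variance p by rewrite /sigma /gwi_sigma betaE gammaE.
have sigma0 : 0 < sigma by rewrite sigmaE divr_gt0.
have nc := pgf_near_critical p0 h0 cp ch p1 h1 cpm pm cpl ch2 pp hp.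
pose a := gwi_pmf xi Y.
have a0 n k : 0 <= a n k by have [] := gwi_pmf_ge0_sum1 inputs n.
have ca n : cvgn (series (a n)) by have [] := gwi_pmf_ge0_sum1 inputs n.
have a1 n : limn (series (a n)) = 1 by have [] := gwi_pmf_ge0_sum1 inputs n.
have HE n (x : R) : 0 <= x < 1 -> pgf (a n) x = hprod (pgf p) (pgf h) n x.
  move=> /andP[x0 x1]; rewrite -(gwi_HE inputs) ?x0 ?ltW //.
  by rewrite (gwi_H_hprod inputs) // x0 ltW.
have H_cvg (x : R) : 0 <= x < 1 -> cvgn (fun n => n%:R `^ sigma * pgf (a n) x).
  move=> x01; rewrite (_ : (fun n => _) = fun n => n%:R `^ sigma * hprod (pgf p) (pgf h) n x).
    by rewrite sigmaE; exact: is_cvg_hprod nc (ltW immigration_mean_gt0) _ x01.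
  by apply/funext => n; rewrite HE.
have H_le : exists C : R, 0 < C /\ forall n (x : R), (0 < n)%N -> 0 <= x < 1 ->
    pgf (a n) x <= C * (n%:R * (1 - x)) `^ (- sigma).
  have [C [C0 HC]] := hprod_le nc (ltW immigration_mean_gt0).
  by exists C; split => // n x n0 x01; rewrite HE // sigmaE; exact: HC.
have H_diag (t : nat -> R) : (forall n, 0 < t n) -> t n @[n --> \oo] --> (0 : R) ->
    pgf (a n) (expR (- t n)) * (1 + half_variance p * n%:R * t n) `^ sigma @[n --> \oo] --> (1 : R).
  move=> t0 tlim; rewrite sigmaE; apply: cvg_trans (hprod_diagonal nc (ltW immigration_mean_gt0) t0 tlim).
  apply: near_eq_cvg; apply: nearW => n.
  by rewrite HE // ltW ?expR_gt0 //= expR_lt1 oppr_lt0.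
have a00 : a n 0%N @[n --> \oo] --> (0 : R).
  have zero_lt : 0 <= (0 : R) < sigma by apply/andP.
  have := H0_cvg0 a0 H_le zero_lt; apply: cvg_trans; apply: near_eq_cvg.
  by apply: nearW => n; rewrite powRr0 mul1r pgf0.
have scaled_pgf_limitE (x : R) : 0 <= x <= 1 -> scaled_pgf_limit a sigma x = gwi_U P Z sigma x.
  move=> x01; rewrite /scaled_pgf_limit /gwi_U; congr (limn _); apply/funext => n.
  by rewrite (gwi_HE inputs).
have moment_lim : norming sigma n r * negative_moment a r n @[n --> \oo] -->
    limit_constant (gwi_U P Z sigma) (half_variance p) r sigma.
  rewrite /norming /limit_constant; case: ltrP => [sr|].
    have -> : \int[lebesgue_measure]_(t in `]0, +oo[)
          ((gwi_U P Z sigma (expR (- t)) - gwi_U P Z sigma 0) * t `^ (r - 1)) =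
        \int[lebesgue_measure]_(t in `]0, +oo[)
          ((scaled_pgf_limit a sigma (expR (- t)) - scaled_pgf_limit a sigma 0) * t `^ (r - 1)).
      apply: eq_Rintegral => t /[!inE] /=; rewrite in_itv /= andbT => t0.
      by rewrite !scaled_pgf_limitE ?lexx ?ler01 // expR_ge0 expR_le1 oppr_le0 ltW.
    exact: negative_moment_limit_above.
  rewrite le_eqVlt => /predU1P[->|rs].
    by rewrite eqxx; exact: negative_moment_limit_at.
  by rewrite lt_eqF //; exact: negative_moment_limit_below.
have E : (fun n => norming sigma n r *
    cond_expectation P (fun w => (Z n w)%:R `^ (- r)) [set w | (0 < Z n w)%N]) =
    (fun n => norming sigma n r * negative_moment a r n / (1 - a n 0%N)).
  by apply/funext => n; rewrite (cond_expectation_gwi inputs n r_gt0) mulrA.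
rewrite E -[X in _ --> X]mulr1; apply: cvgM => //.
have : (1 - a n 0%N)^-1 @[n --> \oo] --> ((1 - 0)^-1 : R).
  by apply: cvgV; [rewrite subr0 oner_neq0 | apply: cvgB => //; exact: cvg_cst].
by rewrite subr0 invr1.
Qed.
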